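(* Let $f(x,y,y')$ be a smooth function. The scalar second-order ODE $y''=f(x,y,y')$ is linearizable via point transformations if and only if it has the form $$y''+F_3(x,y)\,{y'}^3+F_2(x,y)\,{y'}^2+F_1(x,y)\,y'+F(x,y)=0$$ and there exist (auxiliary) functions $w(x,y)$ and $z(x,y)$ satisfying $$w_x+z_y=\frac13\left(\frac{\partial F_2}{\partial x}+\frac{\partial F_1}{\partial y}\right)$$ such that the ODE admits the $\lambda$-symmetries equivalent to the canonical pair $\left(\frac{\partial}{\partial y},\lambda_1\right)$ with $$\lambda_1=-F_3\,{y'}^{2}-\left(F_2-w\right)y'-z.$$
   Context: All functions are smooth and everything is local in $(x,y)$: $f$ is defined on $U\times\mathbb{R}$ with $U$ a neighbourhood of a given point $(x_0,y_0)\in\mathbb{R}^2$, and the functions $F_3,F_2,F_1,F,w,z$ of $(x,y)$, and $\phi,\psi$ below, are defined on a (possibly smaller) neighbourhood of $(x_0,y_0)$. Subscripts $x,y$ denote partial derivatives. Linearizable via point transformations: the ODE $y''=f(x,y,y')$ is linearizable via point transformations if there is a point transformation $t=\phi(x,y)$, $u=\psi(x,y)$ with $J=\phi_x\psi_y-\phi_y\psi_x\ne0$ under which it corresponds to the free particle equation $u_{tt}=0$. That is, near $(x_0,y_0)$, the equation $u_{tt}=0$, where $u_t=\frac{\psi_x+\psi_y y'}{\phi_x+\phi_y y'}$ and $u_{tt}=\frac{D_x(u_t)}{\phi_x+\phi_y y'}$ with $D_x=\partial_x+y'\partial_y+y''\partial_{y'}$, is equivalent to $y''=f(x,y,y')$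 wherever $\phi_x+\phi_y y'\neq0$. (Every linear second-order ODE can be transformed to $u_{tt}=0$ by a point transformation.) $\lambda$-symmetries: for the ODE $y''=f(x,y,y')$ put $A=\partial_x+y'\partial_y+f\,\partial_{y'}$. For a smooth function $\lambda(x,y,y')$, the pair $\left(\frac{\partial}{\partial y},\lambda\right)$ is a $\lambda$-symmetry of the ODE if and only if $$\lambda_x+y'\lambda_y+f\,\lambda_{y'}+\lambda^2=f_y+\lambda\,f_{y'}$$ identically in $(x,y,y')$. A general pair $(v,\lambda)$ with $v=\xi(x,y)\partial_x+\eta(x,y)\partial_y$ and characteristic $Q=\eta-\xi y'\not\equiv0$ is equivalent to the canonical pair $\left(\frac{\partial}{\partial y},\lambda+\frac{A(Q)}{Q}\right)$: one is a $\lambda$-symmetry of the ODE if and only if the other is. Hence ''the ODE admits the $\lambda$-symmetries equivalent to the canonical pair $\left(\frac{\partial}{\partial y},\lambda_1\right)$'' means that $\left(\frac{\partial}{\partial y},\lambda_1\right)$ is a $\lambda$-symmetry of the ODE. *)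

(* Defs.v *)
From Stdlib Require Import Reals.
From Coquelicot Require Import Coquelicot.
Open Scope R_scope.

Definition dx (g : R -> R -> R) : R -> R -> R :=
  fun x y => Derive (fun s => g s y) x.
Definition dy (g : R -> R -> R) : R -> R -> R :=
  fun x y => Derive (fun s => g x s) y.

(* Functions of (x, y, p), where p stands for y'. *)
Definition dx3 (g : R -> R -> R -> R) : R -> R -> R -> R :=
  fun x y p => Derive (fun s => g s y p) x.
Definition dy3 (g : R -> R -> R -> R) : R -> R -> R -> R :=
  fun x y p => Derive (fun s => g x s p) y.
Definition dp3 (g : R -> R -> R -> R) : R -> R -> R -> R :=
  fun x y p => Derive (fun s => g x y s) p.

(* Three-variable analogue of Coquelicot's [ex_diff_n].  Like [ex_diff_n] it is
   a condition at a single point; it expresses C^n regularity when required at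
   all points of an open set, which is the only way it is used below. *)
Fixpoint ex_diff3_n (g : R -> R -> R -> R) (n : nat) (x y p : R) : Prop :=
  continuous (fun v : R * R * R => g (fst (fst v)) (snd (fst v)) (snd v))
    (x, y, p) /\
  match n with
  | O => True
  | S m =>
      ex_derive (fun s => g s y p) x /\
      ex_derive (fun s => g x s p) y /\
      ex_derive (fun s => g x y s) p /\
      ex_diff3_n (dx3 g) m x y p /\
      ex_diff3_n (dy3 g) m x y p /\
      ex_diff3_n (dp3 g) m x y p
  end.

(* C^infinity on some neighbourhood V of (x0, y0). *)
Definition smooth_near (g : R -> R -> R) (x0 y0 : R) : Prop :=
  locally_2d (fun x y => forall n, ex_diff_n g n x y) x0 y0.

(* C^infinity on V * R for some neighbourhood V of (x0, y0). *)
Definition smooth3_near (g : R -> R -> R -> R) (x0 y0 : R) : Prop :=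
  locally_2d (fun x y => forall p n, ex_diff3_n g n x y p) x0 y0.

Definition jacobian (phi psi : R -> R -> R) (x y : R) : R :=
  dx phi x y * dy psi x y - dy phi x y * dx psi x y.

Definition point_transformation (phi psi : R -> R -> R) (x0 y0 : R) : Prop :=
  smooth_near phi x0 y0 /\ smooth_near psi x0 y0 /\
  locally_2d (fun x y => jacobian phi psi x y <> 0) x0 y0.

(* The total derivative of g(x, y, y') as a function of x, y, p = y', q = y''. *)
Definition total_D (g : R -> R -> R -> R) (x y p q : R) : R :=
  dx3 g x y p + p * dy3 g x y p + q * dp3 g x y p.

Definition u_t (phi psi : R -> R -> R) (x y p : R) : R :=
  (dx psi x y + dy psi x y * p) / (dx phi x y + dy phi x y * p).

Definition u_tt (phi psi : R -> R -> R) (x y p q : R) : R :=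
  total_D (u_t phi psi) x y p q / (dx phi x y + dy phi x y * p).

Definition linearizable (f : R -> R -> R -> R) (x0 y0 : R) : Prop :=
  exists phi psi : R -> R -> R,
    point_transformation phi psi x0 y0 /\
    locally_2d (fun x y => forall p q : R,
      dx phi x y + dy phi x y * p <> 0 ->
      (u_tt phi psi x y p q = 0 <-> q = f x y p)) x0 y0.

(* The vector field A = d/dx + y' d/dy + f d/dy' of the equation y'' = f. *)
Definition field_A (f g : R -> R -> R -> R) (x y p : R) : R :=
  total_D g x y p (f x y p).

(* The pair (d/dy, lam) is a lambda-symmetry of y'' = f near (x0, y0). *)
Definition lambda_symmetry_dy (f lam : R -> R -> R -> R) (x0 y0 : R) : Prop :=
  smooth3_near lam x0 y0 /\
  locally_2d (fun x y => forall p : R,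
    field_A f lam x y p + lam x y p ^ 2
    = dy3 f x y p + lam x y p * dp3 f x y p) x0 y0.

(* Main.v *)
Require Import Defs.
From Stdlib Require Import Reals Lra Lia List.
From Coquelicot Require Import Coquelicot.
Import ListNotations.
Open Scope R_scope.

(** The point transformations that linearize an equation are the local charts
    (phi, psi) in which its solution curves become straight lines.  For a
    function g of the plane consider the linear system

      g_xx = (2 z - F1) g_x + F g_y,
      g_xy = - w g_x + z g_y,
      g_yy = - F3 g_x + (F2 - 2 w) g_y.

    If phi and psi both solve it, with nonzero Jacobian J, then substitution
    gives u_tt = J (y'' + F3 y'^3 + F2 y'^2 + F1 y' + F) / (phi_x + phi_y y')^3
    ([u_tt_affine_charts]), so that the chart linearizes the cubic equation.
    Conversely, given any chart, Cramer's rule solves these six equations for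
    w, z, F3, F2, F1, F: the functions w and z are nothing but the coordinates
    of the mixed second derivatives of phi and psi in the coframe of the chart.

    The system has two independent gradients of solutions at each point exactly
    when it is compatible, that is, when the two expressions it yields for each
    of the third derivatives g_xxy and g_xyy agree
    ([affine_chart_compatibility]).  These integrability conditions are four
    first-order equations for w and z, here called [lie_system].  On the other
    side, for a cubic right-hand side the determining equation of the pair
    (d/dy, lambda_1) is a polynomial in y'; its coefficients of degree 4 and 3
    vanish identically, and the remaining three equations, together with the
    prescribed value of w_x + z_y, are equivalent to [lie_system]
    ([lambda_symmetry_lie_system]).  So the theorem reduces to two facts: a
    linearizing chart forces [lie_system], by the symmetry of third derivatives
    and J <> 0 ([lie_system_of_affine_charts]), and [lie_system] produces a
    linearizing chart, by a Frobenius theorem ([affine_chart_exists]).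

    The Frobenius theorem ([flat_linear_system]) is proved for linear systems
    V_x = A V, V_y = B V with A_y + A B = B_x + B A.  Both equations imply
    V_xy = (A_y + A B) V, a Goursat problem with data on the two coordinate
    lines through the base point; it is an integral equation in which only
    continuity of V matters, solved by contraction ([goursat_problem]).  The
    defects P = V_x - A V and Q = V_y - B V of its solution satisfy P_y = - A Q
    and Q_x = - B P with P = 0 on one line and Q = 0 on the other, and
    therefore vanish.  Smoothness of the solution follows from the equations
    themselves by induction on the order. *)

(** * Rules for one-variable derivatives *)

Lemma is_derive_eq (f : R -> R) (x a b : R) :
  is_derive f x a -> a = b -> is_derive f x b.
Proof. now intros H <-. Qed.

Lemma is_derive_Rplus (f g : R -> R) (x a b : R) :
  is_derive f x a -> is_derive g x b -> is_derive (fun t => f t + g t) x (a + b).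
Proof. exact (is_derive_plus f g x a b). Qed.

Lemma is_derive_Rminus (f g : R -> R) (x a b : R) :
  is_derive f x a -> is_derive g x b -> is_derive (fun t => f t - g t) x (a - b).
Proof. exact (is_derive_minus f g x a b). Qed.

Lemma is_derive_Ropp (f : R -> R) (x a : R) :
  is_derive f x a -> is_derive (fun t => - f t) x (- a).
Proof. exact (is_derive_opp f x a). Qed.

Lemma is_derive_Rmult (f g : R -> R) (x a b : R) :
  is_derive f x a -> is_derive g x b ->
  is_derive (fun t => f t * g t) x (a * g x + f x * b).
Proof.
  intros Hf Hg; apply (is_derive_mult f g x a b Hf Hg); intros; apply Rmult_comm.
Qed.

Lemma is_derive_Rconst (c x : R) : is_derive (fun _ => c) x 0.
Proof. exact (is_derive_const c x). Qed.

Lemma is_derive_Rid (x : R) : is_derive (fun t => t) x 1.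
Proof. exact (is_derive_id x). Qed.

(** Leaves are matched syntactically against the hypotheses: unification up to
    conversion would unfold partial derivatives into limits.  The case
    [Rmult c] is [fun t => c * t] after eta-reduction. *)
Ltac derive_rules :=
  repeat lazymatch goal with
    | |- is_derive (fun _ => ?c) _ _ => apply is_derive_Rconst
    | |- is_derive (fun t => t) _ _ => apply is_derive_Rid
    | |- is_derive (fun t => _ + _) _ _ => apply is_derive_Rplus
    | |- is_derive (fun t => _ - _) _ _ => apply is_derive_Rminus
    | |- is_derive (fun t => - _) _ _ => apply is_derive_Ropp
    | |- is_derive (fun t => _ * _) _ _ => apply is_derive_Rmult
    | |- is_derive (Rmult ?c) _ _ =>
        apply (is_derive_Rmult (fun _ => c) (fun t => t))
    | |- is_derive (fun t => _ ^ _) _ _ => apply is_derive_pow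
    | |- is_derive (fun t => _ / _) _ _ => apply is_derive_div
    | H : is_derive ?f ?x _ |- is_derive ?f ?x _ => exact H
    end.

(** * Smooth functions of two variables on open regions *)

Definition open_region (D : R -> R -> Prop) : Prop :=
  forall x y, D x y -> locally_2d D x y.

(** On an open region the pointwise condition [ex_diff_n] is C^n regularity, and
    it becomes stable under products and quotients, which it is not at a single
    point. *)
Definition Cn_on (D : R -> R -> Prop) (n : nat) (g : R -> R -> R) : Prop :=
  forall x y, D x y -> ex_diff_n g n x y.

Definition smooth_on (D : R -> R -> Prop) (g : R -> R -> R) : Prop :=
  forall n, Cn_on D n g.

Lemma Cn_on_continuity D n g x y :
  Cn_on D n g -> D x y -> continuity_2d_pt g x y.
Proof. intros H Hxy; specialize (H x y Hxy); destruct n; apply H. Qed.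

Lemma Cn_on_le D n m g : (m <= n)%nat -> Cn_on D n g -> Cn_on D m g.
Proof. intros Hm H x y Hxy; apply ex_diff_n_m with n; auto. Qed.

Lemma Cn_on_dx D n g : Cn_on D (S n) g -> Cn_on D n (dx g).
Proof. intros H x y Hxy; apply (H x y Hxy). Qed.

Lemma Cn_on_dy D n g : Cn_on D (S n) g -> Cn_on D n (dy g).
Proof. intros H x y Hxy; apply (H x y Hxy). Qed.

Lemma Cn_on_is_derive_x D n g x y :
  Cn_on D (S n) g -> D x y -> is_derive (fun s => g s y) x (dx g x y).
Proof. intros H Hxy; apply Derive_correct, (H x y Hxy). Qed.

Lemma Cn_on_is_derive_y D n g x y :
  Cn_on D (S n) g -> D x y -> is_derive (fun s => g x s) y (dy g x y).
Proof. intros H Hxy; apply Derive_correct, (H x y Hxy). Qed.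

(** The induction principle behind all the closure lemmas below: partial
    derivatives may be given by any functions that agree with them on the
    region. *)
Lemma Cn_on_intro D n (g gx gy : R -> R -> R) :
  open_region D ->
  (forall x y, D x y -> continuity_2d_pt g x y) ->
  (forall x y, D x y -> is_derive (fun s => g s y) x (gx x y)) ->
  (forall x y, D x y -> is_derive (fun s => g x s) y (gy x y)) ->
  Cn_on D n gx -> Cn_on D n gy -> Cn_on D (S n) g.
Proof.
  intros HD Hc Hx Hy Hgx Hgy x y Hxy.
  repeat split.
  - auto.
  - eexists; apply Hx, Hxy.
  - eexists; apply Hy, Hxy.
  - apply ex_diff_n_ext_loc with gx; [ | now apply Hgx].
    apply locally_2d_impl with (2 := HD x y Hxy), locally_2d_forall.
    intros u v Huv; symmetry; apply is_derive_unique, Hx, Huv.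
  - apply ex_diff_n_ext_loc with gy; [ | now apply Hgy].
    apply locally_2d_impl with (2 := HD x y Hxy), locally_2d_forall.
    intros u v Huv; symmetry; apply is_derive_unique, Hy, Huv.
Qed.

Lemma Cn_on_const D n c : Cn_on D n (fun _ _ => c).
Proof.
  revert c; induction n; intros c x y Hxy.
  - split; [apply continuity_2d_pt_const | exact I].
  - repeat split.
    + apply continuity_2d_pt_const.
    + apply ex_derive_const.
    + apply ex_derive_const.
    + apply ex_diff_n_ext_loc with (fun _ _ => 0); [ | now apply IHn].
      apply locally_2d_forall; intros; now rewrite Derive_const.
    + apply ex_diff_n_ext_loc with (fun _ _ => 0); [ | now apply IHn].
      apply locally_2d_forall; intros; now rewrite Derive_const.
Qed.

Lemma Cn_on_plus D n f g :
  open_region D -> Cn_on D n f -> Cn_on D n g ->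
  Cn_on D n (fun x y => f x y + g x y).
Proof.
  intros HD; revert f g; induction n; intros f g Hf Hg.
  - intros x y Hxy; split; [ | exact I].
    apply continuity_2d_pt_plus; eapply Cn_on_continuity; eauto.
  - apply Cn_on_intro with (gx := fun x y => dx f x y + dx g x y)
      (gy := fun x y => dy f x y + dy g x y); auto using Cn_on_dx, Cn_on_dy;
      intros x y Hxy.
    + apply continuity_2d_pt_plus; eapply Cn_on_continuity; eauto.
    + apply is_derive_Rplus; eapply Cn_on_is_derive_x; eauto.
    + apply is_derive_Rplus; eapply Cn_on_is_derive_y; eauto.
Qed.

Lemma Cn_on_mult D n f g :
  open_region D -> Cn_on D n f -> Cn_on D n g ->
  Cn_on D n (fun x y => f x y * g x y).
Proof.
  intros HD; revert f g; induction n; intros f g Hf Hg.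
  - intros x y Hxy; split; [ | exact I].
    apply continuity_2d_pt_mult; eapply Cn_on_continuity; eauto.
  - assert (Hf' := Cn_on_le D (S n) n f (Nat.le_succ_diag_r n) Hf).
    assert (Hg' := Cn_on_le D (S n) n g (Nat.le_succ_diag_r n) Hg).
    apply Cn_on_intro with (gx := fun x y => dx f x y * g x y + f x y * dx g x y)
      (gy := fun x y => dy f x y * g x y + f x y * dy g x y);
      auto using Cn_on_dx, Cn_on_dy, Cn_on_plus; intros x y Hxy.
    + apply continuity_2d_pt_mult; eapply Cn_on_continuity; eauto.
    + apply (is_derive_Rmult (fun s => f s y) (fun s => g s y));
        eapply Cn_on_is_derive_x; eauto.
    + apply is_derive_Rmult; eapply Cn_on_is_derive_y; eauto.
Qed.

Lemma Cn_on_opp D n f :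
  open_region D -> Cn_on D n f -> Cn_on D n (fun x y => - f x y).
Proof.
  intros HD Hf x y Hxy.
  apply ex_diff_n_ext_loc with (fun x y => -1 * f x y).
  - apply locally_2d_forall; intros; ring.
  - apply (Cn_on_mult D n (fun _ _ => -1) f); auto using Cn_on_const.
Qed.

Lemma Cn_on_inv D n f :
  open_region D -> (forall x y, D x y -> f x y <> 0) ->
  Cn_on D n f -> Cn_on D n (fun x y => / f x y).
Proof.
  intros HD Hnz; induction n; intros Hf.
  - intros x y Hxy; split; [ | exact I].
    apply continuity_2d_pt_inv; auto; eapply Cn_on_continuity; eauto.
  - assert (Hf' := Cn_on_le D (S n) n f (Nat.le_succ_diag_r n) Hf).
    apply Cn_on_intro with (gx := fun x y => - dx f x y * (/ f x y * / f x y))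
      (gy := fun x y => - dy f x y * (/ f x y * / f x y));
      auto 6 using Cn_on_dx, Cn_on_dy, Cn_on_mult, Cn_on_opp; intros x y Hxy.
    + apply continuity_2d_pt_inv; auto; eapply Cn_on_continuity; eauto.
    + apply is_derive_eq with (- dx f x y / f x y ^ 2).
      * apply (is_derive_inv (fun s => f s y)); auto.
        eapply Cn_on_is_derive_x; eauto.
      * field; auto.
    + apply is_derive_eq with (- dy f x y / f x y ^ 2).
      * apply (is_derive_inv (fun s => f x s)); auto.
        eapply Cn_on_is_derive_y; eauto.
      * field; auto.
Qed.

Lemma smooth_on_const D c : smooth_on D (fun _ _ => c).
Proof. intros n; apply Cn_on_const. Qed.

Lemma smooth_on_plus D f g :
  open_region D -> smooth_on D f -> smooth_on D g ->
  smooth_on D (fun x y => f x y + g x y).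
Proof. intros HD Hf Hg n; now apply Cn_on_plus. Qed.

Lemma smooth_on_opp D f :
  open_region D -> smooth_on D f -> smooth_on D (fun x y => - f x y).
Proof. intros HD Hf n; now apply Cn_on_opp. Qed.

Lemma smooth_on_minus D f g :
  open_region D -> smooth_on D f -> smooth_on D g ->
  smooth_on D (fun x y => f x y - g x y).
Proof. intros HD Hf Hg; now apply smooth_on_plus; [ | | apply smooth_on_opp]. Qed.

Lemma smooth_on_mult D f g :
  open_region D -> smooth_on D f -> smooth_on D g ->
  smooth_on D (fun x y => f x y * g x y).
Proof. intros HD Hf Hg n; now apply Cn_on_mult. Qed.

Lemma smooth_on_div D f g :
  open_region D -> (forall x y, D x y -> g x y <> 0) ->
  smooth_on D f -> smooth_on D g ->
  smooth_on D (fun x y => f x y / g x y).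
Proof.
  intros HD Hnz Hf Hg n; apply Cn_on_mult; auto; now apply Cn_on_inv.
Qed.

Lemma smooth_on_dx D g : smooth_on D g -> smooth_on D (dx g).
Proof. intros H n; apply Cn_on_dx, H. Qed.

Lemma smooth_on_dy D g : smooth_on D g -> smooth_on D (dy g).
Proof. intros H n; apply Cn_on_dy, H. Qed.

Lemma smooth_on_continuity D g x y :
  smooth_on D g -> D x y -> continuity_2d_pt g x y.
Proof. intros H; exact (Cn_on_continuity D 0 g x y (H 0%nat)). Qed.

Lemma smooth_on_is_derive_x D g x y :
  smooth_on D g -> D x y -> is_derive (fun s => g s y) x (dx g x y).
Proof. intros H; exact (Cn_on_is_derive_x D 0 g x y (H 1%nat)). Qed.

Lemma smooth_on_is_derive_y D g x y :
  smooth_on D g -> D x y -> is_derive (fun s => g x s) y (dy g x y).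
Proof. intros H; exact (Cn_on_is_derive_y D 0 g x y (H 1%nat)). Qed.

Lemma smooth_on_Schwarz D g x y :
  open_region D -> smooth_on D g -> D x y -> dx (dy g) x y = dy (dx g) x y.
Proof.
  intros HD Hg Hxy.
  assert (Hgx := smooth_on_dx D g Hg); assert (Hgy := smooth_on_dy D g Hg).
  apply (Schwarz g x y).
  - apply locally_2d_impl with (2 := HD x y Hxy), locally_2d_forall.
    intros u v Huv; repeat split.
    + eexists; now apply smooth_on_is_derive_x with D.
    + eexists; now apply smooth_on_is_derive_y with D.
    + exists (dx (dy g) u v); now apply (smooth_on_is_derive_x D (dy g)).
    + exists (dy (dx g) u v); now apply (smooth_on_is_derive_y D (dx g)).
  - apply (smooth_on_continuity D (dx (dy g))); auto using smooth_on_dx.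
  - apply (smooth_on_continuity D (dy (dx g))); auto using smooth_on_dy.
Qed.

(** The set of points near which a property holds is open; used with a
    conjunction, it provides a single open region on which finitely many local
    hypotheses hold at once. *)
Lemma open_region_locally P : open_region (locally_2d P).
Proof.
  intros x y; apply locally_2d_impl_strong, locally_2d_forall; auto.
Qed.

Lemma smooth_near_on D g x0 y0 :
  open_region D -> D x0 y0 -> smooth_on D g -> smooth_near g x0 y0.
Proof.
  intros HD H0 Hg.
  apply locally_2d_impl with (2 := HD x0 y0 H0), locally_2d_forall.
  intros u v Huv n; now apply Hg.
Qed.

(** * Smooth functions of three variables *)

(** Regularity over the cylinder D x R, since the slope variable ranges over the
    whole line. *)
Definition Cn3_on (D : R -> R -> Prop) (n : nat) (g : R -> R -> R -> R) : Prop :=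
  forall x y p, D x y -> ex_diff3_n g n x y p.

Definition continuous3 (g : R -> R -> R -> R) (x y p : R) : Prop :=
  continuous (fun v : R * R * R => g (fst (fst v)) (snd (fst v)) (snd v)) (x, y, p).

Lemma locally_2d_locally_3 (P : R -> R -> Prop) x y p :
  locally_2d P x y ->
  locally (x, y, p) (fun v : R * R * R => P (fst (fst v)) (snd (fst v))).
Proof.
  intros [d Hd]; exists d; intros [[u v] q] [[Hu Hv] _]; simpl.
  now apply Hd.
Qed.

(** Regularity at a point depends only on the values over the cylinder, because
    partial derivatives there are those of functions that agree nearby. *)
Lemma ex_diff3_n_ext D n g h x y p :
  open_region D -> D x y -> (forall u v q, D u v -> g u v q = h u v q) ->
  ex_diff3_n g n x y p -> ex_diff3_n h n x y p.
Proof.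
  intros HD; revert g h x y p; induction n; intros g h x y p Hxy E H.
  all: assert (Hc : continuous3 h x y p)
    by (apply continuous_ext_loc with (2 := proj1 H);
        apply filter_imp with (2 := locally_2d_locally_3 _ _ _ p (HD x y Hxy));
        intros v Hv; now apply E).
  - now split.
  - assert (Ex : forall u v q, D u v -> locally u (fun s => g s v q = h s v q)).
    { intros u v q Huv; generalize (locally_2d_1d_const_y _ _ _ (HD u v Huv)).
      apply filter_imp; intros s Hs; now apply E. }
    assert (Ey : forall u v q, D u v -> locally v (fun s => g u s q = h u s q)).
    { intros u v q Huv; generalize (locally_2d_1d_const_x _ _ _ (HD u v Huv)).
      apply filter_imp; intros s Hs; now apply E. }
    destruct H as (_ & Hx & Hy & Hp & Hgx & Hgy & Hgp).
    repeat split; auto.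
    + apply ex_derive_ext_loc with (2 := Hx); now apply Ex.
    + apply ex_derive_ext_loc with (2 := Hy); now apply Ey.
    + apply ex_derive_ext with (2 := Hp); intros t; now apply E.
    + apply IHn with (dx3 g); auto; intros; apply Derive_ext_loc; now apply Ex.
    + apply IHn with (dy3 g); auto; intros; apply Derive_ext_loc; now apply Ey.
    + apply IHn with (dp3 g); auto; intros; apply Derive_ext; intros; now apply E.
Qed.

Lemma Cn3_on_intro D n (g gx gy gp : R -> R -> R -> R) :
  open_region D ->
  (forall x y p, D x y -> continuous3 g x y p) ->
  (forall x y p, D x y -> is_derive (fun s => g s y p) x (gx x y p)) ->
  (forall x y p, D x y -> is_derive (fun s => g x s p) y (gy x y p)) ->
  (forall x y p, D x y -> is_derive (fun s => g x y s) p (gp x y p)) ->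
  Cn3_on D n gx -> Cn3_on D n gy -> Cn3_on D n gp -> Cn3_on D (S n) g.
Proof.
  intros HD Hc Hx Hy Hp Hgx Hgy Hgp x y p Hxy.
  repeat split.
  - now apply Hc.
  - eexists; now apply Hx.
  - eexists; now apply Hy.
  - eexists; now apply Hp.
  - apply (ex_diff3_n_ext D) with gx; auto.
    intros; symmetry; now apply is_derive_unique, Hx.
  - apply (ex_diff3_n_ext D) with gy; auto.
    intros; symmetry; now apply is_derive_unique, Hy.
  - apply (ex_diff3_n_ext D) with gp; auto.
    intros; symmetry; now apply is_derive_unique, Hp.
Qed.

Lemma Cn3_on_continuous D n g x y p :
  Cn3_on D n g -> D x y -> continuous3 g x y p.
Proof. intros H Hxy; specialize (H x y p Hxy); destruct n; apply H. Qed.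

Lemma Cn3_on_le D n g : Cn3_on D (S n) g -> Cn3_on D n g.
Proof.
  revert g; induction n; intros g H x y p Hxy.
  - split; [apply (H x y p Hxy) | exact I].
  - destruct (H x y p Hxy) as (Hc & Hx & Hy & Hp & _).
    repeat split; auto; apply IHn; auto; clear - H; intros x y p Hxy;
      apply (H x y p Hxy).
Qed.

Lemma Cn3_on_dx3 D n g : Cn3_on D (S n) g -> Cn3_on D n (dx3 g).
Proof. intros H x y p Hxy; apply (H x y p Hxy). Qed.

Lemma Cn3_on_dy3 D n g : Cn3_on D (S n) g -> Cn3_on D n (dy3 g).
Proof. intros H x y p Hxy; apply (H x y p Hxy). Qed.

Lemma Cn3_on_dp3 D n g : Cn3_on D (S n) g -> Cn3_on D n (dp3 g).
Proof. intros H x y p Hxy; apply (H x y p Hxy). Qed.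

Lemma Cn3_on_is_derive D n g x y p :
  Cn3_on D (S n) g -> D x y ->
  is_derive (fun s => g s y p) x (dx3 g x y p) /\
  is_derive (fun s => g x s p) y (dy3 g x y p) /\
  is_derive (fun s => g x y s) p (dp3 g x y p).
Proof.
  intros H Hxy; destruct (H x y p Hxy) as (_ & Hx & Hy & Hp & _).
  repeat split; now apply Derive_correct.
Qed.

Lemma Cn3_on_plus D n f g :
  open_region D -> Cn3_on D n f -> Cn3_on D n g ->
  Cn3_on D n (fun x y p => f x y p + g x y p).
Proof.
  intros HD; revert f g; induction n; intros f g Hf Hg;
  assert (Hc : forall x y p, D x y -> continuous3 (fun x y p => f x y p + g x y p) x y p)
    by (intros x y p Hxy;
        exact (continuous_plus _ _ _ (Cn3_on_continuous D _ f x y p Hf Hxy)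
          (Cn3_on_continuous D _ g x y p Hg Hxy))).
  - now split; [apply Hc | ].
  - apply Cn3_on_intro with (gx := fun x y p => dx3 f x y p + dx3 g x y p)
      (gy := fun x y p => dy3 f x y p + dy3 g x y p)
      (gp := fun x y p => dp3 f x y p + dp3 g x y p); auto.
    1-3: intros x y p Hxy;
      destruct (Cn3_on_is_derive D n f x y p Hf Hxy) as (fx & fy & fp);
      destruct (Cn3_on_is_derive D n g x y p Hg Hxy) as (gx & gy & gp);
      now apply is_derive_Rplus.
    + apply IHn; now apply Cn3_on_dx3.
    + apply IHn; now apply Cn3_on_dy3.
    + apply IHn; now apply Cn3_on_dp3.
Qed.

Lemma Cn3_on_mult D n f g :
  open_region D -> Cn3_on D n f -> Cn3_on D n g ->
  Cn3_on D n (fun x y p => f x y p * g x y p).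
Proof.
  intros HD; revert f g; induction n; intros f g Hf Hg;
  assert (Hc : forall x y p, D x y -> continuous3 (fun x y p => f x y p * g x y p) x y p)
    by (intros x y p Hxy;
        exact (continuous_mult _ _ _ (Cn3_on_continuous D _ f x y p Hf Hxy)
          (Cn3_on_continuous D _ g x y p Hg Hxy))).
  - now split; [apply Hc | ].
  - assert (Hf' := Cn3_on_le D n f Hf).
    assert (Hg' := Cn3_on_le D n g Hg).
    apply Cn3_on_intro with
      (gx := fun x y p => dx3 f x y p * g x y p + f x y p * dx3 g x y p)
      (gy := fun x y p => dy3 f x y p * g x y p + f x y p * dy3 g x y p)
      (gp := fun x y p => dp3 f x y p * g x y p + f x y p * dp3 g x y p); auto.
    1-3: intros x y p Hxy;
      destruct (Cn3_on_is_derive D n f x y p Hf Hxy) as (fx & fy & fp);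
      destruct (Cn3_on_is_derive D n g x y p Hg Hxy) as (gx & gy & gp).
    + now apply (is_derive_Rmult (fun s => f s y p) (fun s => g s y p)).
    + now apply (is_derive_Rmult (fun s => f x s p) (fun s => g x s p)).
    + now apply (is_derive_Rmult (fun s => f x y s) (fun s => g x y s)).
    + apply Cn3_on_plus; auto; apply IHn; auto; now apply Cn3_on_dx3.
    + apply Cn3_on_plus; auto; apply IHn; auto; now apply Cn3_on_dy3.
    + apply Cn3_on_plus; auto; apply IHn; auto; now apply Cn3_on_dp3.
Qed.

Lemma Cn3_on_lift D n g :
  open_region D -> Cn_on D n g -> Cn3_on D n (fun x y _ => g x y).
Proof.
  intros HD; revert g; induction n; intros g Hg;
  assert (Hc : forall x y p, D x y -> continuous3 (fun x y _ => g x y) x y p).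
  1, 3: intros x y p Hxy;
    apply (continuous_comp (fun v : R * R * R => fst v)
      (fun v : R * R => g (fst v) (snd v)));
    [apply continuous_fst
    | apply continuity_2d_pt_filterlim; eapply Cn_on_continuity; eauto].
  - now split; [apply Hc | ].
  - apply Cn3_on_intro with (gx := fun x y _ => dx g x y)
      (gy := fun x y _ => dy g x y) (gp := fun _ _ _ => 0); auto.
    + intros; eapply Cn_on_is_derive_x; eauto.
    + intros; eapply Cn_on_is_derive_y; eauto.
    + intros; apply is_derive_Rconst.
    + apply IHn, Cn_on_dx, Hg.
    + apply IHn, Cn_on_dy, Hg.
    + apply IHn, Cn_on_const.
Qed.

Lemma Cn3_on_slope D n : open_region D -> Cn3_on D n (fun _ _ p => p).
Proof.
  intros HD.
  assert (Hc : forall x y p, D x y -> continuous3 (fun _ _ p => p) x y p)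
    by (intros; apply continuous_snd).
  destruct n.
  - now split; [apply Hc | ].
  - apply Cn3_on_intro with (gx := fun _ _ _ => 0)
      (gy := fun _ _ _ => 0) (gp := fun _ _ _ => 1); auto;
      try (intros; first [apply is_derive_Rconst | apply is_derive_Rid]);
      apply (Cn3_on_lift D n (fun _ _ => _)); auto using Cn_on_const.
Qed.

(** * Contractions on spaces of real functions *)

Lemma le_0_of_le_geometric (a C : R) : (forall n, a <= C * (/ 2) ^ n) -> a <= 0.
Proof.
  intros H.
  assert (L : is_lim_seq (fun n => C * (/ 2) ^ n) 0).
  { replace (Finite 0) with (Rbar_mult C 0) by (simpl; f_equal; ring).
    apply is_lim_seq_scal_l, is_lim_seq_geom; rewrite Rabs_pos_eq; lra. }
  exact (is_lim_seq_le _ _ a 0 H (is_lim_seq_const a) L).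
Qed.

(** The Banach fixed point theorem for the uniform distance between real
    functions, which need not be bounded: only the first step is.  The iterates
    form a uniformly Cauchy sequence, so their limit inherits [P], here a
    regularity property that makes the contraction estimate meaningful. *)
Lemma contraction_fixed_point (X : Type) (P : (X -> R) -> Prop)
  (T : (X -> R) -> X -> R) (V0 : X -> R) (M : R) :
  P V0 -> (forall V, P V -> P (T V)) ->
  (forall V, (forall eps : posreal,
     exists U, P U /\ forall x, Rabs (V x - U x) <= eps) -> P V) ->
  (forall U V s, P U -> P V -> (forall x, Rabs (U x - V x) <= s) ->
     forall x, Rabs (T U x - T V x) <= s / 2) ->
  (forall x, Rabs (T V0 x - V0 x) <= M) ->
  exists V, P V /\ (forall x, T V x = V x) /\
    forall x, Rabs (V x - V0 x) <= 2 * M.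
Proof.
  intros H0 HT Hlim Hcontr HM.
  set (W := fun n => Nat.iter n T V0).
  assert (HW : forall n, P (W n)) by (induction n; simpl; auto).
  assert (Hstep : forall n x, Rabs (W (S n) x - W n x) <= M * (/ 2) ^ n).
  { induction n; intros x.
    - simpl; rewrite Rmult_1_r; apply HM.
    - simpl W; replace (M * (/ 2) ^ S n) with (M * (/ 2) ^ n / 2)
        by (simpl; field).
      now apply Hcontr; [apply (HW (S n)) | apply (HW n) | ]. }
  assert (Hdist : forall n k x,
    Rabs (W (n + k)%nat x - W n x) <= 2 * M * (/ 2) ^ n - 2 * M * (/ 2) ^ (n + k)).
  { induction k; intros x.
    - rewrite Nat.add_0_r, Rminus_diag, Rabs_R0; lra.
    - rewrite Nat.add_succ_r.
      replace (W (S (n + k)) x - W n x)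
        with ((W (S (n + k)) x - W (n + k)%nat x) + (W (n + k)%nat x - W n x))
        by ring.
      eapply Rle_trans; [apply Rabs_triang | ].
      specialize (IHk x); specialize (Hstep (n + k)%nat x); simpl pow; lra. }
  assert (HMpos : forall x : X, 0 <= M)
    by (intros x; eapply Rle_trans; [apply Rabs_pos | apply (HM x)]).
  assert (Hpow : forall n, 0 < (/ 2) ^ n) by (intros; apply pow_lt; lra).
  assert (Hdist' : forall n k x,
    Rabs (W (n + k)%nat x - W n x) <= 2 * M * (/ 2) ^ n).
  { intros n k x; eapply Rle_trans; [apply Hdist | ].
    assert (0 <= M * (/ 2) ^ (n + k)); [ | lra].
    apply Rmult_le_pos; [now apply HMpos | left; apply Hpow]. }
  assert (Hsmall : forall eps : posreal, exists n, 2 * M * (/ 2) ^ n < eps).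
  { intros eps.
    assert (L : is_lim_seq (fun n => 2 * M * (/ 2) ^ n) 0).
    { replace (Finite 0) with (Rbar_mult (2 * M) 0) by (simpl; f_equal; ring).
      apply is_lim_seq_scal_l, is_lim_seq_geom; rewrite Rabs_pos_eq; lra. }
    apply is_lim_seq_spec in L; destruct (L eps) as [n Hn]; exists n.
    specialize (Hn n (le_n n)); rewrite Rminus_0_r in Hn.
    eapply Rle_lt_trans; [apply Rle_abs | exact Hn]. }
  assert (Hcv : forall x, ex_finite_lim_seq (fun n => W n x)).
  { intros x; apply ex_lim_seq_cauchy_corr; intros eps.
    destruct (Hsmall (mkposreal _ (is_pos_div_2 eps))) as [n0 Hn0]; simpl in Hn0.
    exists n0; intros n m Hn Hm.
    replace n with (n0 + (n - n0))%nat by lia.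
    replace m with (n0 + (m - n0))%nat by lia.
    assert (Hn' := Hdist' n0 (n - n0)%nat x).
    assert (Hm' := Hdist' n0 (m - n0)%nat x).
    apply Rabs_le_between in Hn'; apply Rabs_le_between in Hm'.
    apply Rabs_lt_between; lra. }
  set (V := fun x => real (Lim_seq (fun n => W n x))).
  assert (HV : forall n x, Rabs (V x - W n x) <= 2 * M * (/ 2) ^ n).
  { intros n x.
    assert (L := Lim_seq_correct' _ (Hcv x)); fold (V x) in L.
    apply (is_lim_seq_incr_n _ n) in L.
    assert (L' := is_lim_seq_abs _ _
      (is_lim_seq_minus' _ _ _ _ L (is_lim_seq_const (W n x)))).
    refine (is_lim_seq_le _ _ (Rabs _) (2 * M * (/ 2) ^ n) _ L'
      (is_lim_seq_const _)).
    intros k; simpl; rewrite Nat.add_comm; apply Hdist'. }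
  assert (PV : P V).
  { apply Hlim; intros eps; destruct (Hsmall eps) as [n Hn].
    exists (W n); split; [apply HW | ]; intros x; specialize (HV n x); lra. }
  exists V; repeat split; auto.
  - intros x; apply Rminus_diag_uniq, Rabs_eq_0, Rle_antisym; [ | apply Rabs_pos].
    apply le_0_of_le_geometric with (2 * M); intros n.
    assert (H1 := Hcontr V (W n) _ PV (HW n) (HV n) x).
    assert (H2 := HV (S n) x); simpl in H2.
    apply Rabs_le_between in H1; apply Rabs_le_between in H2.
    apply Rabs_le_between; lra.
  - intros x; specialize (HV 0%nat x); simpl in HV; lra.
Qed.

(** * Integrals of continuous functions of two variables *)

Definition continuous_2d (g : R -> R -> R) : Prop :=
  forall x y, continuity_2d_pt g x y.

Lemma continuity_2d_pt_swap g x y :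
  continuity_2d_pt g x y -> continuity_2d_pt (fun u v => g v u) y x.
Proof.
  intros H eps; destruct (H eps) as [d Hd]; exists d; intros u v Hu Hv.
  now apply Hd.
Qed.

Lemma continuity_2d_pt_fst g x y :
  continuity_2d_pt g x y -> continuous (fun s => g s y) x.
Proof.
  intros H; apply continuity_2d_pt_filterlim in H.
  apply (continuous_comp_2 (fun s : R => s) (fun _ : R => y) g);
    [apply continuous_id | apply continuous_const | exact H].
Qed.

Lemma continuity_2d_pt_snd g x y :
  continuity_2d_pt g x y -> continuous (fun t => g x t) y.
Proof. intros H; now apply (continuity_2d_pt_fst (fun u v => g v u)), continuity_2d_pt_swap. Qed.

Lemma continuity_2d_pt_comp g a b x y :
  continuous a x -> continuous b y -> continuity_2d_pt g (a x) (b y) ->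
  continuity_2d_pt (fun u v => g (a u) (b v)) x y.
Proof.
  intros Ha Hb Hg; apply continuity_2d_pt_filterlim.
  apply continuity_2d_pt_filterlim in Hg.
  apply (continuous_comp_2 (fun z : R * R => a (fst z)) (fun z => b (snd z)) g).
  - apply continuous_comp; [apply continuous_fst | exact Ha].
  - apply continuous_comp; [apply continuous_snd | exact Hb].
  - exact Hg.
Qed.

Lemma ex_RInt_continuous_R (h : R -> R) a b :
  (forall s, continuous h s) -> ex_RInt h a b.
Proof. intros H; apply (ex_RInt_continuous h); auto. Qed.

Lemma Rabs_RInt_le (h : R -> R) a b M :
  (forall s, continuous h s) ->
  (forall s, Rmin a b <= s <= Rmax a b -> Rabs (h s) <= M) ->
  Rabs (RInt h a b) <= Rabs (b - a) * M.
Proof.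
  intros Hc HM; apply (norm_RInt_le_const_abs h a b); [exact HM | ].
  now apply (RInt_correct h), ex_RInt_continuous_R.
Qed.

Lemma RInt_Rminus (h k : R -> R) a b :
  (forall s, continuous h s) -> (forall s, continuous k s) ->
  RInt (fun s => h s - k s) a b = RInt h a b - RInt k a b.
Proof. intros; apply (RInt_minus h k); now apply ex_RInt_continuous_R. Qed.

(** Moving the upper bound changes the integral little because the integrand is
    locally bounded; moving the parameter does because the integrand is
    uniformly continuous along the segment of integration. *)
Lemma continuity_2d_pt_RInt_fst g a :
  continuous_2d g -> continuous_2d (fun x y => RInt (fun s => g s y) a x).
Proof.
  intros Hg x y eps.
  assert (Hs : forall v s, continuous (fun s => g s v) s)
    by (intros; apply continuity_2d_pt_fst, Hg).
  assert (He1 : 0 < eps / 2 / (Rabs (x - a) + 1)).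
  { apply Rdiv_lt_0_compat; [apply is_pos_div_2 | ].
    assert (H := Rabs_pos (x - a)); lra. }
  destruct (uniform_continuity_2d_1d g (Rmin a x) (Rmax a x) y
    (fun s _ => Hg s y) (mkposreal _ He1)) as [d1 Hd1].
  destruct (Hg x y (mkposreal 1 Rlt_0_1)) as [d2 Hd2]; simpl in Hd1, Hd2.
  set (N := Rabs (g x y) + 1).
  assert (HN : 0 < N) by (unfold N; assert (H := Rabs_pos (g x y)); lra).
  assert (He2 : 0 < eps / 2 / N)
    by (apply Rdiv_lt_0_compat; [apply is_pos_div_2 | exact HN]).
  assert (Hd : 0 < Rmin d1 (Rmin d2 (eps / 2 / N)))
    by (repeat apply Rmin_pos; auto using cond_pos).
  exists (mkposreal _ Hd); simpl; intros u v Hu Hv.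
  apply Rmin_Rgt_l in Hu; destruct Hu as [_ Hu].
  apply Rmin_Rgt_l in Hu; destruct Hu as [Hu2 Hu3].
  apply Rmin_Rgt_l in Hv; destruct Hv as [Hv1 Hv].
  apply Rmin_Rgt_l in Hv; destruct Hv as [Hv2 _].
  assert (EC : RInt (fun s => g s v) a u
    = RInt (fun s => g s v) a x + RInt (fun s => g s v) x u).
  { symmetry; apply (RInt_Chasles (fun s => g s v));
      now apply ex_RInt_continuous_R. }
  rewrite EC.
  replace (_ - _) with ((RInt (fun s => g s v) a x - RInt (fun s => g s y) a x)
    + RInt (fun s => g s v) x u) by ring.
  rewrite <- RInt_Rminus by auto.
  eapply Rle_lt_trans; [apply Rabs_triang | ].
  assert (B1 : Rabs (RInt (fun s => g s v - g s y) a x)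
     <= Rabs (x - a) * (eps / 2 / (Rabs (x - a) + 1))).
  { apply Rabs_RInt_le.
    - intros s; now apply (continuous_minus (fun s => g s v) (fun s => g s y)).
    - intros s Hsx; left; apply Hd1; auto.
      + assert (H := cond_pos d1); lra.
      + apply Rabs_lt_between in Hv1; lra.
      + rewrite Rminus_diag, Rabs_R0; apply cond_pos. }
  assert (B2 : Rabs (RInt (fun s => g s v) x u) <= Rabs (u - x) * N).
  { apply Rabs_RInt_le; auto; intros s Hsx.
    assert (Hs' : Rabs (s - x) < d2).
    { apply Rle_lt_trans with (2 := Hu2); revert Hsx.
      unfold Rmin, Rmax; destruct Rle_dec; unfold Rabs;
        repeat destruct Rcase_abs; lra. }
    specialize (Hd2 s v Hs' Hv2).
    replace (g s v) with ((g s v - g x y) + g x y) by ring.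
    eapply Rle_trans; [apply Rabs_triang | unfold N; lra]. }
  assert (B3 : Rabs (u - x) * N < eps / 2).
  { apply Rmult_lt_compat_r with (1 := HN) in Hu3.
    replace (eps / 2) with (eps / 2 / N * N) by (field; lra); exact Hu3. }
  assert (B4 : Rabs (x - a) * (eps / 2 / (Rabs (x - a) + 1)) <= eps / 2).
  { assert (H := Rabs_pos (x - a)).
    replace (eps / 2) with ((Rabs (x - a) + 1) * (eps / 2 / (Rabs (x - a) + 1))) at 2
      by (field; lra).
    apply Rmult_le_compat_r; lra. }
  lra.
Qed.

Lemma continuity_2d_pt_RInt_snd g b :
  continuous_2d g -> continuous_2d (fun x y => RInt (fun t => g x t) b y).
Proof.
  intros Hg x y; apply continuity_2d_pt_swap.
  apply (continuity_2d_pt_RInt_fst (fun u v => g v u)).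
  intros u v; now apply continuity_2d_pt_swap.
Qed.

Lemma is_derive_RInt_upper (h : R -> R) a x :
  (forall s, continuous h s) -> is_derive (fun x => RInt h a x) x (h x).
Proof.
  intros Hh; apply (is_derive_RInt h (fun x => RInt h a x) a x); auto.
  apply filter_forall; intros u.
  now apply (RInt_correct h), ex_RInt_continuous_R.
Qed.

Lemma is_derive_RInt_RInt_fst g a b x y :
  continuous_2d g ->
  is_derive (fun u => RInt (fun s => RInt (fun t => g s t) b y) a u) x
    (RInt (fun t => g x t) b y).
Proof.
  intros Hg; apply (is_derive_RInt_upper (fun s => RInt (fun t => g s t) b y)).
  intros s; apply (continuity_2d_pt_fst (fun s y => RInt (fun t => g s t) b y)).
  now apply continuity_2d_pt_RInt_snd.
Qed.

(** Differentiation under the outer integral.  Together with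
    [is_derive_RInt_RInt_fst] this replaces the exchange of the order of
    integration. *)
Lemma is_derive_RInt_RInt_snd g a b x y :
  continuous_2d g ->
  is_derive (fun v => RInt (fun s => RInt (fun t => g s t) b v) a x) y
    (RInt (fun s => g s y) a x).
Proof.
  intros Hg.
  assert (Hin : forall s v, is_derive (fun v => RInt (fun t => g s t) b v) v (g s v)).
  { intros s v; apply (is_derive_RInt_upper (fun t => g s t)).
    intros; now apply continuity_2d_pt_snd. }
  replace (RInt (fun s => g s y) a x)
    with (RInt (fun s => Derive (fun v => RInt (fun t => g s t) b v) y) a x)
    by (apply RInt_ext; intros s _; apply is_derive_unique, Hin).
  apply (is_derive_RInt_param (fun v s => RInt (fun t => g s t) b v)).
  - apply filter_forall; intros v s _; eexists; apply Hin.
  - intros s _; apply continuity_2d_pt_ext with (fun v s => g s v).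
    + intros v u; symmetry; apply is_derive_unique, Hin.
    + now apply continuity_2d_pt_swap.
  - apply filter_forall; intros v; apply ex_RInt_continuous_R; intros s.
    apply (continuity_2d_pt_fst (fun s y => RInt (fun t => g s t) b y)).
    now apply continuity_2d_pt_RInt_snd.
Qed.

(** * Vectors and matrices over a finite index type *)

Section FiniteIndex.

Variable I : Type.
Variable l : list I.
Hypothesis l_all : forall i, In i l.

Definition lsum (f : I -> R) : R := fold_right (fun k s => f k + s) 0 l.

Definition act (M : I -> I -> R) (v : I -> R) (i : I) : R :=
  lsum (fun k => M i k * v k).

Definition matmul (M N : I -> I -> R) (i k : I) : R :=
  lsum (fun j => M i j * N j k).

Lemma lsum_ext f g : (forall k, f k = g k) -> lsum f = lsum g.
Proof.
  intros H; unfold lsum; clear l_all; induction l; simpl; [ | rewrite H, IHl0]; auto.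
Qed.

Lemma lsum_plus f g : lsum (fun k => f k + g k) = lsum f + lsum g.
Proof.
  unfold lsum; clear l_all; induction l; simpl; [ring | rewrite IHl0; ring].
Qed.

Lemma lsum_scal c f : lsum (fun k => c * f k) = c * lsum f.
Proof.
  unfold lsum; clear l_all; induction l; simpl; [ring | rewrite IHl0; ring].
Qed.

(** The exchange of two finite sums, here for the associativity
    [act_matmul]. *)
Lemma lsum_comm (f : I -> I -> R) :
  lsum (fun i => lsum (fun k => f i k)) = lsum (fun k => lsum (fun i => f i k)).
Proof.
  unfold lsum at 1 3; clear l_all.
  assert (E : forall l1 l2 : list I,
    fold_right (fun i s => fold_right (fun k s => f i k + s) 0 l2 + s) 0 l1
    = fold_right (fun k s => fold_right (fun i s => f i k + s) 0 l1 + s) 0 l2).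
  { induction l1 as [ | i l1 IH]; intros l2; simpl.
    - induction l2; simpl; [ | rewrite <- IHl2]; ring.
    - rewrite IH; clear IH; induction l2; simpl; [ring | rewrite <- IHl2; ring]. }
  apply E.
Qed.

Lemma lsum_le f g : (forall k, f k <= g k) -> lsum f <= lsum g.
Proof.
  intros H; unfold lsum; clear l_all; induction l as [ | k l0 IH]; simpl; [lra | ].
  specialize (H k); lra.
Qed.

Lemma lsum_nonneg f : (forall k, 0 <= f k) -> 0 <= lsum f.
Proof.
  intros H; unfold lsum; clear l_all; induction l as [ | k l0 IH]; simpl; [lra | ].
  specialize (H k); lra.
Qed.

Lemma lsum_term_le f k : (forall j, 0 <= f j) -> f k <= lsum f.
Proof.
  intros H; generalize (l_all k); unfold lsum; clear l_all.
  induction l as [ | j l0 IH]; simpl; [tauto | ].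
  assert (Hs : 0 <= fold_right (fun k s => f k + s) 0 l0).
  { clear IH; induction l0 as [ | m l1 IH']; simpl; [lra | ].
    specialize (H m); lra. }
  intros [<- | Hk]; [ | apply IH in Hk]; specialize (H j); lra.
Qed.

Lemma Rabs_lsum_le f : Rabs (lsum f) <= lsum (fun k => Rabs (f k)).
Proof.
  unfold lsum; clear l_all; induction l; simpl.
  - rewrite Rabs_R0; lra.
  - eapply Rle_trans; [apply Rabs_triang | lra].
Qed.

Lemma lsum_continuity (f : I -> R -> R -> R) x y :
  (forall k, continuity_2d_pt (f k) x y) ->
  continuity_2d_pt (fun u v => lsum (fun k => f k u v)) x y.
Proof.
  intros H; unfold lsum; clear l_all; induction l; simpl.
  - apply continuity_2d_pt_const.
  - now apply continuity_2d_pt_plus.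
Qed.

Lemma lsum_is_derive (f : I -> R -> R) (d : I -> R) x :
  (forall k, is_derive (f k) x (d k)) ->
  is_derive (fun t => lsum (fun k => f k t)) x (lsum d).
Proof.
  intros H; unfold lsum; clear l_all; induction l; simpl.
  - apply is_derive_Rconst.
  - now apply is_derive_Rplus.
Qed.

Lemma act_minus M u v i :
  act M (fun k => u k - v k) i = act M u i - act M v i.
Proof.
  unfold act.
  rewrite (lsum_ext _ (fun k => M i k * u k + -1 * (M i k * v k)))
    by (intros; ring).
  rewrite lsum_plus, lsum_scal; ring.
Qed.

Lemma act_matmul M N v i : act (matmul M N) v i = act M (fun k => act N v k) i.
Proof.
  unfold act, matmul.
  rewrite (lsum_ext _ (fun k => lsum (fun j => v k * (M i j * N j k)))).
  2: intros k; rewrite lsum_scal; ring.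
  rewrite lsum_comm; apply lsum_ext; intros j.
  rewrite <- lsum_scal; apply lsum_ext; intros k; ring.
Qed.

Lemma act_plus_l M N v i :
  act (fun i k => M i k + N i k) v i = act M v i + act N v i.
Proof.
  unfold act; rewrite <- lsum_plus; apply lsum_ext; intros; ring.
Qed.

Lemma act_continuity (M : I -> I -> R -> R -> R) (v : I -> R -> R -> R) i x y :
  (forall i k, continuity_2d_pt (M i k) x y) ->
  (forall k, continuity_2d_pt (v k) x y) ->
  continuity_2d_pt
    (fun s t => act (fun i k => M i k s t) (fun k => v k s t) i) x y.
Proof.
  intros HM Hv; apply (lsum_continuity (fun k s t => M i k s t * v k s t)).
  intros k; now apply continuity_2d_pt_mult.
Qed.

Lemma act_is_derive (M M' : I -> I -> R -> R) (v v' : I -> R -> R) i t :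
  (forall i k, is_derive (M i k) t (M' i k t)) ->
  (forall k, is_derive (v k) t (v' k t)) ->
  is_derive (fun s => act (fun i k => M i k s) (fun k => v k s) i) t
    (act (fun i k => M' i k t) (fun k => v k t) i
     + act (fun i k => M i k t) (fun k => v' k t) i).
Proof.
  intros HM Hv; unfold act; rewrite <- lsum_plus.
  apply (lsum_is_derive (fun k s => M i k s * v k s)).
  intros k; now apply (is_derive_Rmult (M i k) (v k)).
Qed.

(** A crude matrix norm; it dominates the operator norm for the maximum
    norm on vectors. *)
Definition entry_sum (M : I -> I -> R) : R :=
  lsum (fun i => lsum (fun k => Rabs (M i k))).

Lemma Rabs_act_le M v i K s :
  entry_sum M <= K -> 0 <= s -> (forall k, Rabs (v k) <= s) ->
  Rabs (act M v i) <= K * s.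
Proof.
  intros HK Hs Hv; unfold act.
  eapply Rle_trans; [apply Rabs_lsum_le | ].
  apply Rle_trans with (lsum (fun k => s * Rabs (M i k))).
  - apply lsum_le; intros k; rewrite Rabs_mult, Rmult_comm.
    apply Rmult_le_compat_r; [apply Rabs_pos | apply Hv].
  - rewrite lsum_scal, Rmult_comm; apply Rmult_le_compat_r; auto.
    eapply Rle_trans; [ | exact HK].
    apply (lsum_term_le (fun i => lsum (fun k => Rabs (M i k)))).
    intros j; apply lsum_nonneg; intros; apply Rabs_pos.
Qed.

Lemma entry_sum_locally_bounded (M : I -> I -> R -> R -> R) x y :
  (forall i k, continuity_2d_pt (M i k) x y) ->
  exists K, 0 <= K /\
    locally_2d (fun u v => entry_sum (fun i k => M i k u v) <= K) x y.
Proof.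
  intros H.
  assert (Hc : continuity_2d_pt (fun u v => entry_sum (fun i k => M i k u v)) x y).
  { apply (lsum_continuity (fun i u v => lsum (fun k => Rabs (M i k u v)))).
    intros i; apply (lsum_continuity (fun k u v => Rabs (M i k u v))).
    intros k; apply (continuity_1d_2d_pt_comp Rabs); auto.
    apply Rcontinuity_abs. }
  exists (entry_sum (fun i k => M i k x y) + 1); split.
  - assert (0 <= entry_sum (fun i k => M i k x y)); [ | lra].
    apply lsum_nonneg; intros i; apply lsum_nonneg; intros; apply Rabs_pos.
  - apply locally_2d_impl with (2 := Hc (mkposreal 1 Rlt_0_1)), locally_2d_forall.
    intros u v Huv; apply Rabs_lt_between in Huv; simpl in Huv; lra.
Qed.

(** * The Goursat problem *)

(** The retraction onto the segment of radius [d] around [a].  Composing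
    with it extends functions from a closed square to globally continuous
    ones. *)
Definition clamp (a d x : R) : R := Rmax (a - d) (Rmin (a + d) x).

Lemma clamp_id a d x : Rabs (x - a) <= d -> clamp a d x = x.
Proof.
  intros H; apply Rabs_le_between in H; unfold clamp.
  rewrite Rmin_right, Rmax_right; lra.
Qed.

Lemma clamp_near a d x : 0 <= d -> Rabs (clamp a d x - a) <= d.
Proof.
  intros H; unfold clamp, Rmax, Rmin.
  apply Rabs_le_between; repeat destruct Rle_dec; lra.
Qed.

Lemma clamp_continuous a d x : continuous (clamp a d) x.
Proof.
  apply filterlim_locally; intros eps; exists eps; intros u Hu.
  unfold ball in *; simpl in *; unfold AbsRing_ball, abs, minus, plus, opp in *;
    simpl in *.
  eapply Rle_lt_trans; [ | exact Hu].
  unfold clamp, Rmax, Rmin, Rabs; repeat destruct Rle_dec;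
    repeat destruct Rcase_abs; lra.
Qed.

Definition act_on (M : I -> I -> R -> R -> R) (V : I -> R -> R -> R) (i : I)
  (x y : R) : R :=
  act (fun i k => M i k x y) (fun k => V k x y) i.

Section GoursatIntegral.

Variables A B C : I -> I -> R -> R -> R.
Hypothesis A_cont : forall i k, continuous_2d (A i k).
Hypothesis B_cont : forall i k, continuous_2d (B i k).
Hypothesis C_cont : forall i k, continuous_2d (C i k).
Variables x0 y0 : R.

(** The solution of V_xy = C V with V_x = A V on the line y = y0, V_y = B V on the
    line x = x0 and V = v0 at the corner is the fixed point of v0 plus this
    expression. *)
Definition goursat_integral (V : I -> R -> R -> R) (i : I) (x y : R) : R :=
  RInt (fun s => act_on A V i s y0) x0 x + RInt (fun t => act_on B V i x0 t) y0 y
  + RInt (fun s => RInt (fun t => act_on C V i s t) y0 y) x0 x.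

Lemma act_on_continuous_2d M V i :
  (forall i k, continuous_2d (M i k)) -> (forall k, continuous_2d (V k)) ->
  continuous_2d (act_on M V i).
Proof.
  intros HM HV x y; apply act_continuity; intros; [apply HM | apply HV].
Qed.

Lemma goursat_integral_continuous V i :
  (forall k, continuous_2d (V k)) -> continuous_2d (goursat_integral V i).
Proof.
  intros HV x y; unfold goursat_integral.
  repeat apply continuity_2d_pt_plus.
  - apply (continuity_2d_pt_RInt_fst (fun s _ => act_on A V i s y0)).
    intros u v; apply (continuity_2d_pt_comp (act_on A V i) (fun s => s) (fun _ => y0)).
    + apply continuous_id.
    + apply continuous_const.
    + now apply act_on_continuous_2d.
  - apply (continuity_2d_pt_RInt_snd (fun _ t => act_on B V i x0 t)).
    intros u v; apply (continuity_2d_pt_comp (act_on B V i) (fun _ => x0) (fun t => t)).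
    + apply continuous_const.
    + apply continuous_id.
    + now apply act_on_continuous_2d.
  - apply (continuity_2d_pt_RInt_fst (fun s y => RInt (fun t => act_on C V i s t) y0 y)).
    apply (continuity_2d_pt_RInt_snd (act_on C V i)).
    now apply act_on_continuous_2d.
Qed.

Lemma goursat_integral_minus U V i x y :
  (forall k, continuous_2d (U k)) -> (forall k, continuous_2d (V k)) ->
  goursat_integral (fun k x y => U k x y - V k x y) i x y
  = goursat_integral U i x y - goursat_integral V i x y.
Proof.
  intros HU HV.
  assert (E : forall M s t, act_on M (fun k x y => U k x y - V k x y) i s t
    = act_on M U i s t - act_on M V i s t) by (intros; apply act_minus).
  unfold goursat_integral.
  rewrite (RInt_ext (fun s => act_on A _ i s y0)
    (fun s => act_on A U i s y0 - act_on A V i s y0)) by (intros; apply E).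
  rewrite (RInt_ext (fun t => act_on B _ i x0 t)
    (fun t => act_on B U i x0 t - act_on B V i x0 t)) by (intros; apply E).
  rewrite (RInt_ext (fun s => RInt (fun t => act_on C _ i s t) y0 y)
    (fun s => RInt (fun t => act_on C U i s t) y0 y
              - RInt (fun t => act_on C V i s t) y0 y)).
  2: { intros s _; rewrite <- RInt_Rminus.
       - apply RInt_ext; intros; apply E.
       - intros; apply (continuity_2d_pt_snd (act_on C U i)); now apply act_on_continuous_2d.
       - intros; apply (continuity_2d_pt_snd (act_on C V i)); now apply act_on_continuous_2d. }
  rewrite (RInt_Rminus (fun s => act_on A U i s y0) (fun s => act_on A V i s y0)).
  2: intros; apply (continuity_2d_pt_fst (act_on A U i)); now apply act_on_continuous_2d.
  2: intros; apply (continuity_2d_pt_fst (act_on A V i)); now apply act_on_continuous_2d.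
  rewrite (RInt_Rminus (fun t => act_on B U i x0 t) (fun t => act_on B V i x0 t)).
  2: intros; apply (continuity_2d_pt_snd (act_on B U i)); now apply act_on_continuous_2d.
  2: intros; apply (continuity_2d_pt_snd (act_on B V i)); now apply act_on_continuous_2d.
  rewrite (RInt_Rminus (fun s => RInt (fun t => act_on C U i s t) y0 y)
    (fun s => RInt (fun t => act_on C V i s t) y0 y)).
  2: intros; apply (continuity_2d_pt_fst (fun s y => RInt (fun t => act_on C U i s t) y0 y)).
  2: now apply continuity_2d_pt_RInt_snd, act_on_continuous_2d.
  2: intros; apply (continuity_2d_pt_fst (fun s y => RInt (fun t => act_on C V i s t) y0 y)).
  2: now apply continuity_2d_pt_RInt_snd, act_on_continuous_2d.
  ring.
Qed.

Variable K : R.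
Hypothesis A_bound : forall x y, entry_sum (fun i k => A i k x y) <= K.
Hypothesis B_bound : forall x y, entry_sum (fun i k => B i k x y) <= K.
Hypothesis C_bound : forall x y, entry_sum (fun i k => C i k x y) <= K.

Lemma Rabs_act_on_le M V i x y s :
  (forall x y, entry_sum (fun i k => M i k x y) <= K) ->
  0 <= s -> (forall k x y, Rabs (V k x y) <= s) ->
  Rabs (act_on M V i x y) <= K * s.
Proof. intros HM Hs HV; now apply Rabs_act_le. Qed.

Lemma Rabs_goursat_inner_le V i s d x y :
  (forall k, continuous_2d (V k)) -> 0 <= K -> 0 <= s -> 
  (forall k x y, Rabs (V k x y) <= s) -> Rabs (y - y0) <= d ->
  Rabs (RInt (fun t => act_on C V i x t) y0 y) <= d * (K * s).
Proof.
  intros HV HK Hs HVs Hy.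
  eapply Rle_trans; [apply Rabs_RInt_le with (M := K * s) | ].
  - intros; apply (continuity_2d_pt_snd (act_on C V i)); now apply act_on_continuous_2d.
  - intros; now apply Rabs_act_on_le.
  - apply Rmult_le_compat_r; auto using Rmult_le_pos.
Qed.

Lemma Rabs_goursat_integral_le V i x y s d :
  (forall k, continuous_2d (V k)) -> 0 <= K -> 0 <= s -> 0 <= d <= 1 ->
  (forall k x y, Rabs (V k x y) <= s) ->
  Rabs (x - x0) <= d -> Rabs (y - y0) <= d ->
  Rabs (goursat_integral V i x y) <= 3 * d * K * s.
Proof.
  intros HV HK Hs Hd HVs Hx Hy; unfold goursat_integral.
  assert (HKs : 0 <= K * s) by now apply Rmult_le_pos.
  assert (B1 : Rabs (RInt (fun s => act_on A V i s y0) x0 x) <= d * (K * s)).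
  { eapply Rle_trans; [apply Rabs_RInt_le with (M := K * s) | ].
    - intros; apply (continuity_2d_pt_fst (act_on A V i)); now apply act_on_continuous_2d.
    - intros; now apply Rabs_act_on_le.
    - now apply Rmult_le_compat_r. }
  assert (B2 : Rabs (RInt (fun t => act_on B V i x0 t) y0 y) <= d * (K * s)).
  { eapply Rle_trans; [apply Rabs_RInt_le with (M := K * s) | ].
    - intros; apply (continuity_2d_pt_snd (act_on B V i)); now apply act_on_continuous_2d.
    - intros; now apply Rabs_act_on_le.
    - now apply Rmult_le_compat_r. }
  assert (B3 : Rabs (RInt (fun s => RInt (fun t => act_on C V i s t) y0 y) x0 x)
    <= d * (K * s)).
  { eapply Rle_trans; [apply Rabs_RInt_le with (M := d * (K * s)) | ].
    - intros; apply (continuity_2d_pt_fst (fun s y => RInt (fun t => act_on C V i s t) y0 y)).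
      now apply continuity_2d_pt_RInt_snd, act_on_continuous_2d.
    - intros; now apply Rabs_goursat_inner_le.
    - apply Rle_trans with (1 * (d * (K * s))); [ | lra].
      apply Rmult_le_compat_r; [apply Rmult_le_pos | ]; lra. }
  eapply Rle_trans; [apply Rabs_triang | ].
  eapply Rle_trans; [apply Rplus_le_compat_r, Rabs_triang | ].
  lra.
Qed.

End GoursatIntegral.

(** The Goursat problem is solvable near the corner for continuous coefficients:
    on a small square the integral operator halves distances.  Since
    [X] and [Y] are integrals of continuous functions, the mixed derivatives
    exist although [V] is only known to be continuous to begin with.  The bound
    [M] is what the uniqueness argument of [flat_linear_system] starts from. *)
Lemma goursat_problem (A B C : I -> I -> R -> R -> R) (v0 : I -> R) (x0 y0 : R) :
  locally_2d (fun x y => forall i k, continuity_2d_pt (A i k) x y /\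
    continuity_2d_pt (B i k) x y /\ continuity_2d_pt (C i k) x y) x0 y0 ->
  exists (d M : R) (V X Y : I -> R -> R -> R), 0 < d /\
    (forall i, V i x0 y0 = v0 i) /\
    forall i x y, Rabs (x - x0) < d -> Rabs (y - y0) < d ->
      continuity_2d_pt (V i) x y /\
      is_derive (fun s => V i s y) x (X i x y) /\
      is_derive (fun t => V i x t) y (Y i x y) /\
      is_derive (fun t => X i x t) y (act_on C V i x y) /\
      is_derive (fun s => Y i s y) x (act_on C V i x y) /\
      X i x y0 = act_on A V i x y0 /\ Y i x0 y = act_on B V i x0 y /\
      Rabs (V i x y) <= M /\ Rabs (X i x y) <= M /\ Rabs (Y i x y) <= M.
Proof.
  intros Hloc.
  assert (Hpt := locally_2d_singleton _ _ _ Hloc).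
  destruct (entry_sum_locally_bounded A x0 y0 (fun i k => proj1 (Hpt i k)))
    as (KA & HKA & HA).
  destruct (entry_sum_locally_bounded B x0 y0
    (fun i k => proj1 (proj2 (Hpt i k)))) as (KB & HKB & HB).
  destruct (entry_sum_locally_bounded C x0 y0
    (fun i k => proj2 (proj2 (Hpt i k)))) as (KC & HKC & HC).
  clear Hpt.
  destruct (locally_2d_and _ _ _ _ Hloc
    (locally_2d_and _ _ _ _ HA (locally_2d_and _ _ _ _ HB HC))) as [r Hr].
  clear Hloc HA HB HC.
  set (K := KA + KB + KC + 1).
  assert (HK : 1 <= K) by (unfold K; lra).
  (* The integral operator is bounded by 3 d K on the square of radius d, and
     r / 2 keeps the closed square inside the region where the hypotheses
     hold. *)
  set (d := Rmin (r / 2) (/ (8 * K))).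
  assert (Hd : 0 < d).
  { apply Rmin_pos; [apply is_pos_div_2 | apply Rinv_0_lt_compat; lra]. }
  assert (Hdr : d < r).
  { apply Rle_lt_trans with (r / 2); [apply Rmin_l | ].
    assert (H := cond_pos r); lra. }
  assert (HdK : 3 * d * K <= / 2).
  { assert (H : d * (8 * K) <= / (8 * K) * (8 * K))
      by (apply Rmult_le_compat_r; [lra | apply Rmin_r]).
    rewrite Rinv_l in H by lra; lra. }
  assert (Hd1 : d <= 1).
  { assert (H : d * 1 <= d * K) by (apply Rmult_le_compat_l; lra); lra. }
  set (cx := clamp x0 d); set (cy := clamp y0 d).
  assert (Hcx : forall x, Rabs (cx x - x0) <= d) by (intros; apply clamp_near; lra).
  assert (Hcy : forall y, Rabs (cy y - y0) <= d) by (intros; apply clamp_near; lra).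
  assert (Hcx_id : forall x, Rabs (x - x0) < d -> cx x = x)
    by (intros; apply clamp_id; lra).
  assert (Hcy_id : forall y, Rabs (y - y0) < d -> cy y = y)
    by (intros; apply clamp_id; lra).
  set (ext := fun (M : I -> I -> R -> R -> R) i k x y => M i k (cx x) (cy y)).
  assert (Hin : forall x y, (forall i k, continuity_2d_pt (A i k) (cx x) (cy y) /\
    continuity_2d_pt (B i k) (cx x) (cy y) /\ continuity_2d_pt (C i k) (cx x) (cy y))
    /\ entry_sum (fun i k => A i k (cx x) (cy y)) <= KA
    /\ entry_sum (fun i k => B i k (cx x) (cy y)) <= KB
    /\ entry_sum (fun i k => C i k (cx x) (cy y)) <= KC).
  { intros x y; apply Hr; eapply Rle_lt_trans; eauto. }
  assert (Hext : forall M : I -> I -> R -> R -> R,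
    (forall i k x y, continuity_2d_pt (M i k) (cx x) (cy y)) ->
    forall i k, continuous_2d (ext M i k)).
  { intros M HM i k x y; apply (continuity_2d_pt_comp (M i k));
      [apply clamp_continuous | apply clamp_continuous | apply HM]. }
  assert (cA : forall i k, continuous_2d (ext A i k))
    by (apply Hext; intros; apply Hin).
  assert (cB : forall i k, continuous_2d (ext B i k))
    by (apply Hext; intros; apply Hin).
  assert (cC : forall i k, continuous_2d (ext C i k))
    by (apply Hext; intros; apply Hin).
  assert (bA : forall x y, entry_sum (fun i k => ext A i k x y) <= K).
  { intros x y; destruct (Hin x y) as (_ & H & _); unfold ext, K; lra. }
  assert (bB : forall x y, entry_sum (fun i k => ext B i k x y) <= K).
  { intros x y; destruct (Hin x y) as (_ & _ & H & _); unfold ext, K; lra. }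
  assert (bC : forall x y, entry_sum (fun i k => ext C i k x y) <= K).
  { intros x y; destruct (Hin x y) as (_ & _ & _ & H); unfold ext, K; lra. }
  clear Hin Hr Hext.
  (* Clamping the coefficients makes them globally continuous, and clamping the
     point of evaluation makes the bound on J global. *)
  set (J := goursat_integral (ext A) (ext B) (ext C) x0 y0).
  assert (Jc : forall V, (forall k, continuous_2d (V k)) -> forall i, continuous_2d (J V i))
    by (intros; now apply goursat_integral_continuous).
  assert (Jb : forall V s i x y, (forall k, continuous_2d (V k)) -> 0 <= s ->
    (forall k x y, Rabs (V k x y) <= s) -> Rabs (J V i (cx x) (cy y)) <= s / 2).
  { intros V s i x y HV Hs HVs.
    apply Rle_trans with (3 * d * K * s).
    - apply Rabs_goursat_integral_le; auto; lra.
    - unfold Rdiv; rewrite (Rmult_comm s); now apply Rmult_le_compat_r. }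
  set (s0 := lsum (fun k => Rabs (v0 k))).
  assert (Hs0 : 0 <= s0) by (apply lsum_nonneg; intros; apply Rabs_pos).
  assert (Hv0 : forall k, Rabs (v0 k) <= s0)
    by (intros; apply (lsum_term_le (fun k => Rabs (v0 k))); intros; apply Rabs_pos).
  set (cur := fun (W : I * R * R -> R) k x y => W (k, x, y)).
  destruct (contraction_fixed_point (I * R * R)
    (fun W => forall k, continuous_2d (cur W k))
    (fun W z => v0 (fst (fst z))
      + J (cur W) (fst (fst z)) (cx (snd (fst z))) (cy (snd z)))
    (fun z => v0 (fst (fst z))) s0) as (W & HW & HTW & HWb).
  - intros k x y; exact (continuity_2d_pt_const x y (v0 k)).
  - intros W HW k x y.
    change (continuity_2d_pt (fun u v => v0 k + J (cur W) k (cx u) (cy v)) x y).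
    apply continuity_2d_pt_plus; [apply continuity_2d_pt_const | ].
    apply (continuity_2d_pt_comp (J (cur W) k));
      [apply clamp_continuous | apply clamp_continuous | now apply Jc].
  - intros W HW k x y eps.
    assert (He : 0 < eps / 3) by (assert (H := cond_pos eps); lra).
    destruct (HW (mkposreal _ He)) as (U & HU & HUW); simpl in HUW.
    destruct (HU k x y (mkposreal _ He)) as [e Hde]; simpl in Hde.
    exists e; intros u v Hu Hv; specialize (Hde u v Hu Hv).
    assert (H1 := HUW (k, u, v)); assert (H2 := HUW (k, x, y)).
    unfold cur in *.
    apply Rabs_le_between in H1; apply Rabs_le_between in H2.
    apply Rabs_lt_between in Hde; apply Rabs_lt_between; lra.
  - intros U W s HU HW Hs [[i x] y]; simpl.
    replace (_ - _) with (J (cur U) i (cx x) (cy y) - J (cur W) i (cx x) (cy y))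
      by ring.
    unfold J; rewrite <- goursat_integral_minus by auto.
    apply Jb.
    + intros k u v; apply continuity_2d_pt_minus; auto; [apply HU | apply HW].
    + eapply Rle_trans; [apply Rabs_pos | apply (Hs (i, x, y))].
    + intros k u v; apply (Hs (k, u, v)).
  - intros [[i x] y]; simpl.
    replace (_ - _) with (J (cur (fun z => v0 (fst (fst z)))) i (cx x) (cy y)) by ring.
    apply Rle_trans with (s0 / 2); [ | lra].
    apply Jb; auto; intros k u v; [exact (continuity_2d_pt_const u v (v0 k)) | apply Hv0].
  - set (V := cur W).
    assert (HV : forall i x y, Rabs (x - x0) < d -> Rabs (y - y0) < d ->
      V i x y = v0 i + J V i x y).
    { intros i x y Hx Hy; unfold V at 1, cur; rewrite <- HTW; simpl.
      now rewrite Hcx_id, Hcy_id. }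
    assert (HVb : forall k x y, Rabs (V k x y) <= 3 * s0).
    { intros k x y; specialize (HWb (k, x, y)); simpl in HWb.
      specialize (Hv0 k); unfold V, cur.
      apply Rabs_le_between in HWb; apply Rabs_le_between in Hv0.
      apply Rabs_le_between; lra. }
    assert (Hext_on : forall M i x y, Rabs (x - x0) < d -> Rabs (y - y0) < d ->
      act_on (ext M) V i x y = act_on M V i x y).
    { intros M i x y Hx Hy; unfold act_on, ext; now rewrite Hcx_id, Hcy_id. }
    assert (Hy0 : Rabs (y0 - y0) < d) by now rewrite Rminus_diag, Rabs_R0.
    assert (Hx0 : Rabs (x0 - x0) < d) by now rewrite Rminus_diag, Rabs_R0.
    assert (cAV := fun i => act_on_continuous_2d (ext A) V i cA HW).
    assert (cBV := fun i => act_on_continuous_2d (ext B) V i cB HW).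
    assert (cCV := fun i => act_on_continuous_2d (ext C) V i cC HW).
    assert (Hloc : forall a u, Rabs (u - a) < d ->
      locally u (fun t => Rabs (t - a) < d)).
    { intros a u Hu.
      assert (He : 0 < d - Rabs (u - a)) by lra.
      exists (mkposreal _ He); intros t Ht.
      change (Rabs (t - u) < d - Rabs (u - a)) in Ht.
      replace (t - a) with ((t - u) + (u - a)) by ring.
      eapply Rle_lt_trans; [apply Rabs_triang | lra]. }
    set (X := fun i x y => act_on (ext A) V i x y0
      + RInt (fun t => act_on (ext C) V i x t) y0 y).
    set (Y := fun i x y => act_on (ext B) V i x0 y
      + RInt (fun s => act_on (ext C) V i s y) x0 x).
    assert (HKs : 0 <= K * (3 * s0)) by (apply Rmult_le_pos; lra).
    exists d, (3 * s0 + 2 * (K * (3 * s0))), V, X, Y.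
    split; [exact Hd | split].
    { intros i; rewrite HV by auto; unfold J, goursat_integral.
      rewrite !RInt_point; unfold zero; simpl; ring. }
    intros i x y Hx Hy.
    assert (Hxy : forall u : R, Rabs u < d -> Rabs u * (K * (3 * s0)) <= K * (3 * s0)).
    { intros u Hu; rewrite <- (Rmult_1_l (K * (3 * s0))) at 2.
      apply Rmult_le_compat_r; lra. }
    refine (conj _ (conj _ (conj _ (conj _ (conj _ (conj _ (conj _ (conj _
      (conj _ _))))))))).
    + apply HW.
    + apply is_derive_ext_loc with (fun s => v0 i + J V i s y).
      { generalize (Hloc x0 x Hx); apply filter_imp; intros s Hs.
        symmetry; now apply HV. }
      apply is_derive_eq with (0 + (act_on (ext A) V i x y0 + 0
        + RInt (fun t => act_on (ext C) V i x t) y0 y)); [ | unfold X; ring].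
      apply is_derive_Rplus; [apply is_derive_Rconst | ].
      unfold J, goursat_integral.
      repeat apply is_derive_Rplus; [ | apply is_derive_Rconst | ].
      * apply (is_derive_RInt_upper (fun s => act_on (ext A) V i s y0)).
        intros; apply (continuity_2d_pt_fst (act_on (ext A) V i)), cAV.
      * now apply is_derive_RInt_RInt_fst.
    + apply is_derive_ext_loc with (fun t => v0 i + J V i x t).
      { generalize (Hloc y0 y Hy); apply filter_imp; intros t Ht.
        symmetry; now apply HV. }
      apply is_derive_eq with (0 + (0 + act_on (ext B) V i x0 y
        + RInt (fun s => act_on (ext C) V i s y) x0 x)); [ | unfold Y; ring].
      apply is_derive_Rplus; [apply is_derive_Rconst | ].
      unfold J, goursat_integral.
      repeat apply is_derive_Rplus; [apply is_derive_Rconst | | ].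
      * apply (is_derive_RInt_upper (fun t => act_on (ext B) V i x0 t)).
        intros; apply (continuity_2d_pt_snd (act_on (ext B) V i)), cBV.
      * now apply is_derive_RInt_RInt_snd.
    + rewrite <- Hext_on by auto.
      apply is_derive_eq with (0 + act_on (ext C) V i x y); [ | ring].
      apply is_derive_Rplus; [apply is_derive_Rconst | ].
      apply (is_derive_RInt_upper (fun t => act_on (ext C) V i x t)).
      intros; apply (continuity_2d_pt_snd (act_on (ext C) V i)), cCV.
    + rewrite <- Hext_on by auto.
      apply is_derive_eq with (0 + act_on (ext C) V i x y); [ | ring].
      apply is_derive_Rplus; [apply is_derive_Rconst | ].
      apply (is_derive_RInt_upper (fun s => act_on (ext C) V i s y)).
      intros; apply (continuity_2d_pt_fst (act_on (ext C) V i)), cCV.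
    + unfold X; rewrite RInt_point, Hext_on by auto; apply Rplus_0_r.
    + unfold Y; rewrite RInt_point, Hext_on by auto; apply Rplus_0_r.
    + specialize (HVb i x y); lra.
    + unfold X; eapply Rle_trans; [apply Rabs_triang | ].
      assert (H1 : Rabs (act_on (ext A) V i x y0) <= K * (3 * s0))
        by (apply Rabs_act_on_le; auto; lra).
      assert (H2 : Rabs (RInt (fun t => act_on (ext C) V i x t) y0 y)
        <= Rabs (y - y0) * (K * (3 * s0))).
      { apply Rabs_RInt_le; intros.
        - apply (continuity_2d_pt_snd (act_on (ext C) V i)), cCV.
        - apply Rabs_act_on_le; auto; lra. }
      specialize (Hxy _ Hy); lra.
    + unfold Y; eapply Rle_trans; [apply Rabs_triang | ].
      assert (H1 : Rabs (act_on (ext B) V i x0 y) <= K * (3 * s0))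
        by (apply Rabs_act_on_le; auto; lra).
      assert (H2 : Rabs (RInt (fun s => act_on (ext C) V i s y) x0 x)
        <= Rabs (x - x0) * (K * (3 * s0))).
      { apply Rabs_RInt_le; intros.
        - apply (continuity_2d_pt_fst (act_on (ext C) V i)), cCV.
        - apply Rabs_act_on_le; auto; lra. }
      specialize (Hxy _ Hx); lra.
Qed.

(** * Flat linear systems *)

Lemma Rabs_le_of_derive (h dh : R -> R) a b m :
  h a = 0 ->
  (forall c, Rmin a b <= c <= Rmax a b -> is_derive h c (dh c) /\ Rabs (dh c) <= m) ->
  Rabs (h b) <= Rabs (b - a) * m.
Proof.
  intros Ha H.
  destruct (MVT_gen h a b dh) as (c & Hc & E).
  - intros c Hc; apply H; lra.
  - intros c Hc; apply continuity_pt_filterlim, (ex_derive_continuous h).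
    eexists; now apply H.
  - rewrite Ha, Rminus_0_r in E; rewrite E, Rabs_mult, Rmult_comm.
    apply Rmult_le_compat_l; [apply Rabs_pos | now apply H].
Qed.

Lemma between_near a b c d :
  Rabs (b - a) < d -> Rmin a b <= c <= Rmax a b -> Rabs (c - a) < d.
Proof.
  intros Hb Hc; eapply Rle_lt_trans; [ | exact Hb].
  revert Hc; unfold Rmin, Rmax, Rabs; destruct Rle_dec;
    repeat destruct Rcase_abs; lra.
Qed.

(** The Frobenius theorem for linear systems in two variables: vanishing
    curvature A_y - B_x + A B - B A = 0 yields a solution through every initial
    vector.  The solution of the Goursat problem for C = A_y + A B has defects
    P = V_x - A V and Q = V_y - B V with P_y = - A Q and Q_x = - B P; the
    curvature condition is what allows C to be read as B_x + B A in the second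
    equation.  On a square with e K at most 1/2 every bound on the defects can
    then be halved. *)
Theorem flat_linear_system (A B : I -> I -> R -> R -> R) (v0 : I -> R) (x0 y0 : R) :
  locally_2d (fun x y => forall i k,
    ex_diff_n (A i k) 1 x y /\ ex_diff_n (B i k) 1 x y) x0 y0 ->
  locally_2d (fun x y => forall i k,
    dy (A i k) x y + matmul (fun i k => A i k x y) (fun i k => B i k x y) i k
    = dx (B i k) x y + matmul (fun i k => B i k x y) (fun i k => A i k x y) i k)
    x0 y0 ->
  exists V : I -> R -> R -> R, (forall i, V i x0 y0 = v0 i) /\
    locally_2d (fun x y => forall i, continuity_2d_pt (V i) x y /\
      is_derive (fun s => V i s y) x (act_on A V i x y) /\
      is_derive (fun t => V i x t) y (act_on B V i x y)) x0 y0.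
Proof.
  intros Hdiff Hflat.
  set (C := fun i k x y => dy (A i k) x y
    + matmul (fun i k => A i k x y) (fun i k => B i k x y) i k).
  assert (Hpt := locally_2d_singleton _ _ _ Hdiff).
  destruct (entry_sum_locally_bounded A x0 y0 (fun i k => proj1 (proj1 (Hpt i k))))
    as (KA & HKA & HA).
  destruct (entry_sum_locally_bounded B x0 y0 (fun i k => proj1 (proj2 (Hpt i k))))
    as (KB & HKB & HB).
  destruct (goursat_problem A B C v0 x0 y0) as (d & M & V & X & Y & Hd & HV0 & HV).
  { apply locally_2d_impl with (2 := Hdiff), locally_2d_forall.
    intros x y H i k; repeat split; try apply H.
    apply continuity_2d_pt_plus; [apply (H i k) | ].
    apply (lsum_continuity (fun j x y => A i j x y * B j k x y)).
    intros j; apply continuity_2d_pt_mult; apply H. }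
  destruct (locally_2d_and _ _ _ _ Hdiff (locally_2d_and _ _ _ _ Hflat
    (locally_2d_and _ _ _ _ HA HB))) as [r Hr].
  clear Hpt Hdiff Hflat HA HB.
  set (K := KA + KB + 1).
  assert (HK : 1 <= K) by (unfold K; lra).
  set (e := Rmin (Rmin d r) (/ (2 * K))).
  assert (He : 0 < e).
  { repeat apply Rmin_pos; auto; [apply cond_pos | apply Rinv_0_lt_compat; lra]. }
  assert (HeK : e * K <= / 2).
  { assert (H : e * (2 * K) <= / (2 * K) * (2 * K))
      by (apply Rmult_le_compat_r; [lra | apply Rmin_r]).
    rewrite Rinv_l in H by lra; lra. }
  assert (Hed : e <= d)
    by (eapply Rle_trans; [apply Rmin_l | apply Rmin_l]).
  assert (Her : e <= r)
    by (eapply Rle_trans; [apply Rmin_l | apply Rmin_r]).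
  set (P := fun i x y => X i x y - act_on A V i x y).
  set (Q := fun i x y => Y i x y - act_on B V i x y).
  assert (Hy0 : Rabs (y0 - y0) < e) by now rewrite Rminus_diag, Rabs_R0.
  assert (Hx0 : Rabs (x0 - x0) < e) by now rewrite Rminus_diag, Rabs_R0.
  assert (HM : forall i : I, 0 <= M).
  { intros i; destruct (HV i x0 y0) as (_ & _ & _ & _ & _ & _ & _ & H & _); try lra.
    eapply Rle_trans; [apply Rabs_pos | exact H]. }
  assert (bA : forall (v : I -> R) s i x y, Rabs (x - x0) < e -> Rabs (y - y0) < e -> 0 <= s ->
    (forall k, Rabs (v k) <= s) -> Rabs (act (fun i k => A i k x y) v i) <= K * s).
  { intros v s i x y Hx Hy Hs Hv; apply Rabs_act_le; auto.
    destruct (Hr x y) as (_ & _ & H & _); try lra; unfold K; lra. }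
  assert (bB : forall (v : I -> R) s i x y, Rabs (x - x0) < e -> Rabs (y - y0) < e -> 0 <= s ->
    (forall k, Rabs (v k) <= s) -> Rabs (act (fun i k => B i k x y) v i) <= K * s).
  { intros v s i x y Hx Hy Hs Hv; apply Rabs_act_le; auto.
    destruct (Hr x y) as (_ & _ & _ & H); try lra; unfold K; lra. }
  assert (HP : forall i x y, Rabs (x - x0) < e -> Rabs (y - y0) < e ->
    is_derive (fun t => P i x t) y (- act_on A Q i x y)).
  { intros i x y Hx Hy.
    apply is_derive_eq with (act_on C V i x y -
      (act (fun i k => dy (A i k) x y) (fun k => V k x y) i
       + act (fun i k => A i k x y) (fun k => Y k x y) i)).
    - apply is_derive_Rminus; [apply HV; lra | ].
      apply (act_is_derive (fun i k t => A i k x t) (fun i k t => dy (A i k) x t)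
        (fun k t => V k x t) (fun k t => Y k x t)).
      + intros j k; destruct (Hr x y) as (H & _); [lra | lra | ].
        exact (Derive_correct _ _ (proj1 (proj2 (proj2 (proj1 (H j k)))))).
      + intros k; apply HV; lra.
    - unfold act_on, C, Q; rewrite act_plus_l, act_matmul, act_minus.
      unfold act_on; ring. }
  assert (HQ : forall i x y, Rabs (x - x0) < e -> Rabs (y - y0) < e ->
    is_derive (fun s => Q i s y) x (- act_on B P i x y)).
  { intros i x y Hx Hy.
    apply is_derive_eq with (act_on C V i x y -
      (act (fun i k => dx (B i k) x y) (fun k => V k x y) i
       + act (fun i k => B i k x y) (fun k => X k x y) i)).
    - apply is_derive_Rminus; [apply HV; lra | ].
      apply (act_is_derive (fun i k s => B i k s y) (fun i k s => dx (B i k) s y)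
        (fun k s => V k s y) (fun k s => X k s y)).
      + intros j k; destruct (Hr x y) as (H & _); [lra | lra | ].
        exact (Derive_correct _ _ (proj1 (proj2 (proj2 (H j k))))).
      + intros k; apply HV; lra.
    - destruct (Hr x y) as (_ & Hf & _); try lra.
      unfold act_on at 1; unfold act at 1, C.
      rewrite (lsum_ext _ (fun k => (dx (B i k) x y
        + matmul (fun i k => B i k x y) (fun i k => A i k x y) i k) * V k x y))
        by (intros k; now rewrite Hf).
      change (lsum _) with (act (fun i k => dx (B i k) x y
        + matmul (fun i k => B i k x y) (fun i k => A i k x y) i k)
        (fun k => V k x y) i).
      unfold act_on, P; rewrite act_plus_l, act_matmul, act_minus.
      unfold act_on; ring. }
  assert (Hgeom : forall n i x y, Rabs (x - x0) < e -> Rabs (y - y0) < e ->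
    Rabs (P i x y) <= (M + K * M) * (/ 2) ^ n /\
    Rabs (Q i x y) <= (M + K * M) * (/ 2) ^ n).
  { induction n; intros i x y Hx Hy.
    - simpl; rewrite Rmult_1_r.
      destruct (HV i x y) as (_ & _ & _ & _ & _ & _ & _ & _ & HX & HY); try lra.
      assert (Hb : forall k, Rabs (V k x y) <= M) by (intros; apply HV; lra).
      assert (HA := bA (fun k => V k x y) M i x y Hx Hy (HM i) Hb).
      assert (HB := bB (fun k => V k x y) M i x y Hx Hy (HM i) Hb).
      split; (eapply Rle_trans; [apply Rabs_triang | ]); rewrite Rabs_Ropp;
        unfold act_on; lra.
    - set (N := (M + K * M) * (/ 2) ^ n) in IHn.
      assert (HN : 0 <= N).
      { apply Rmult_le_pos; [ | apply pow_le; lra].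
        assert (0 <= K * M) by (apply Rmult_le_pos; [lra | auto]).
        specialize (HM i); lra. }
      assert (Hh : forall u, Rabs u < e -> Rabs u * (K * N) <= (M + K * M) * (/ 2) ^ S n).
      { intros u Hu; replace (_ * _ ^ S n) with (/ 2 * N) by (unfold N; simpl; ring).
        rewrite <- Rmult_assoc; apply Rmult_le_compat_r; auto.
        apply Rle_trans with (e * K); auto; apply Rmult_le_compat_r; lra. }
      split; eapply Rle_trans.
      + apply (Rabs_le_of_derive (fun t => P i x t) (fun t => - act_on A Q i x t) y0 y (K * N)).
        * unfold P; destruct (HV i x y0) as (_ & _ & _ & _ & _ & H & _); lra.
        * intros c Hc; assert (Hc' := between_near _ _ _ _ Hy Hc); split; auto.
          rewrite Rabs_Ropp; apply bA; auto; intros; now apply IHn.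
      + now apply Hh.
      + apply (Rabs_le_of_derive (fun s => Q i s y) (fun s => - act_on B P i s y) x0 x (K * N)).
        * unfold Q; destruct (HV i x0 y) as (_ & _ & _ & _ & _ & _ & H & _); lra.
        * intros c Hc; assert (Hc' := between_near _ _ _ _ Hx Hc); split; auto.
          rewrite Rabs_Ropp; apply bB; auto; intros; now apply IHn.
      + now apply Hh. }
  exists V; split; [exact HV0 | ].
  exists (mkposreal e He); simpl; intros x y Hx Hy i.
  assert (Z : forall a, (forall n, Rabs a <= (M + K * M) * (/ 2) ^ n) -> a = 0).
  { intros a Ha; apply Rabs_eq_0, Rle_antisym; [ | apply Rabs_pos].
    exact (le_0_of_le_geometric _ _ Ha). }
  destruct (HV i x y) as (Hc & HVx & HVy & _); try lra.
  split; [exact Hc | split].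
  - apply is_derive_eq with (1 := HVx), Rminus_diag_uniq, Z; intros n.
    now apply Hgeom.
  - apply is_derive_eq with (1 := HVy), Rminus_diag_uniq, Z; intros n.
    now apply Hgeom.
Qed.

Lemma lsum_Cn_on D n (f : I -> R -> R -> R) :
  open_region D -> (forall k, Cn_on D n (f k)) ->
  Cn_on D n (fun x y => lsum (fun k => f k x y)).
Proof.
  intros HD H; unfold lsum; clear l_all; induction l; simpl.
  - apply Cn_on_const.
  - now apply (Cn_on_plus D n (f a)).
Qed.

(** Bootstrap: if all components are C^n, so are A V and B V, which are their
    partial derivatives. *)
Lemma linear_system_solution_smooth D (A B : I -> I -> R -> R -> R)
  (V : I -> R -> R -> R) :
  open_region D ->
  (forall i k, smooth_on D (A i k)) -> (forall i k, smooth_on D (B i k)) ->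
  (forall x y, D x y -> forall i, continuity_2d_pt (V i) x y /\
     is_derive (fun s => V i s y) x (act_on A V i x y) /\
     is_derive (fun t => V i x t) y (act_on B V i x y)) ->
  forall i, smooth_on D (V i).
Proof.
  intros HD HA HB HV i n; revert i; induction n; intros i.
  - intros x y Hxy; split; [now apply HV | exact Logic.I].
  - apply Cn_on_intro with (act_on A V i) (act_on B V i); auto.
    1-3: intros x y Hxy; now apply HV.
    + apply (lsum_Cn_on D n (fun k x y => A i k x y * V k x y)); auto.
      intros k; apply Cn_on_mult; auto; apply HA.
    + apply (lsum_Cn_on D n (fun k x y => B i k x y * V k x y)); auto.
      intros k; apply Cn_on_mult; auto; apply HB.
Qed.

End FiniteIndex.

(** * The determining equations of the lambda-symmetry *)

Definition cubic (F3 F2 F1 F : R -> R -> R) (x y p : R) : R :=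
  F3 x y * p ^ 3 + F2 x y * p ^ 2 + F1 x y * p + F x y.

Definition lam1 (F3 F2 w z : R -> R -> R) (x y p : R) : R :=
  - F3 x y * p ^ 2 - (F2 x y - w x y) * p - z x y.

(** The four integrability conditions of the linear system
    [affine_chart_system] below, solved for the derivatives of w and z. *)
Definition lie_system (F3 F2 F1 F w z : R -> R -> R) (x y : R) : Prop :=
  dx w x y = (2 * dx F2 x y - dy F1 x y) / 3 - F x y * F3 x y + w x y * z x y /\
  dy w x y = dx F3 x y - F1 x y * F3 x y + F2 x y * w x y + F3 x y * z x y
             - w x y ^ 2 /\
  dx z x y = dy F x y + F x y * F2 x y - F x y * w x y - F1 x y * z x y
             + z x y ^ 2 /\
  dy z x y = (2 * dy F1 x y - dx F2 x y) / 3 + F x y * F3 x y - w x y * z x y.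

Lemma quadratic_vanishes (a b c : R) :
  (forall p, a * p ^ 2 + b * p + c = 0) -> a = 0 /\ b = 0 /\ c = 0.
Proof.
  intros H; assert (H0 := H 0); assert (H1 := H 1); assert (H2 := H (-1)); lra.
Qed.

(** The determining equation is polynomial in the slope p.  Its terms of degree
    4 and 3 cancel for every w and z because of the form of lambda_1; its
    coefficients [c2], [c1], [c0] give w_y, w_x - z_y and z_x, and the
    prescribed w_x + z_y separates w_x from z_y. *)
Lemma lambda_symmetry_lie_system D f F3 F2 F1 F w z x y :
  open_region D -> smooth_on D F3 -> smooth_on D F2 -> smooth_on D F1 ->
  smooth_on D F -> smooth_on D w -> smooth_on D z ->
  (forall x y, D x y -> forall p, f x y p = - cubic F3 F2 F1 F x y p) ->
  D x y ->
  (dx w x y + dy z x y = 1 / 3 * (dx F2 x y + dy F1 x y) /\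
   forall p, field_A f (lam1 F3 F2 w z) x y p + lam1 F3 F2 w z x y p ^ 2
     = dy3 f x y p + lam1 F3 F2 w z x y p * dp3 f x y p)
  <-> lie_system F3 F2 F1 F w z x y.
Proof.
  intros HD s3 s2 s1 s0 sw sz Hf Hxy.
  assert (X3 := smooth_on_is_derive_x D F3 x y s3 Hxy).
  assert (Y3 := smooth_on_is_derive_y D F3 x y s3 Hxy).
  assert (X2 := smooth_on_is_derive_x D F2 x y s2 Hxy).
  assert (Y2 := smooth_on_is_derive_y D F2 x y s2 Hxy).
  assert (Y1 := smooth_on_is_derive_y D F1 x y s1 Hxy).
  assert (Y0 := smooth_on_is_derive_y D F x y s0 Hxy).
  assert (Xw := smooth_on_is_derive_x D w x y sw Hxy).
  assert (Yw := smooth_on_is_derive_y D w x y sw Hxy).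
  assert (Xz := smooth_on_is_derive_x D z x y sz Hxy).
  assert (Yz := smooth_on_is_derive_y D z x y sz Hxy).
  assert (Lx : forall p, dx3 (lam1 F3 F2 w z) x y p
    = - dx F3 x y * p ^ 2 - (dx F2 x y - dx w x y) * p - dx z x y).
  { intros p; apply is_derive_unique; unfold lam1.
    eapply is_derive_eq; [derive_rules | cbv beta; ring]. }
  assert (Ly : forall p, dy3 (lam1 F3 F2 w z) x y p
    = - dy F3 x y * p ^ 2 - (dy F2 x y - dy w x y) * p - dy z x y).
  { intros p; apply is_derive_unique; unfold lam1.
    eapply is_derive_eq; [derive_rules | cbv beta; ring]. }
  assert (Lp : forall p, dp3 (lam1 F3 F2 w z) x y p
    = - F3 x y * (2 * p) - (F2 x y - w x y)).
  { intros p; apply is_derive_unique; unfold lam1.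
    eapply is_derive_eq; [derive_rules | cbv beta; simpl; ring]. }
  assert (fy : forall p, dy3 f x y p
    = - (dy F3 x y * p ^ 3 + dy F2 x y * p ^ 2 + dy F1 x y * p + dy F x y)).
  { intros p; apply is_derive_unique.
    apply is_derive_ext_loc with (fun s => - cubic F3 F2 F1 F x s p).
    - generalize (locally_2d_1d_const_x _ _ _ (HD x y Hxy)); apply filter_imp.
      intros s Hs; symmetry; now apply Hf.
    - unfold cubic; eapply is_derive_eq; [derive_rules | cbv beta; ring]. }
  assert (fp : forall p, dp3 f x y p
    = - (F3 x y * (3 * p ^ 2) + F2 x y * (2 * p) + F1 x y)).
  { intros p; apply is_derive_unique.
    apply is_derive_ext with (fun s => - cubic F3 F2 F1 F x y s).
    - intros s; symmetry; now apply Hf.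
    - unfold cubic; eapply is_derive_eq; [derive_rules | cbv beta; simpl; ring]. }
  set (c2 := dy w x y - (dx F3 x y - F1 x y * F3 x y + F2 x y * w x y
    + F3 x y * z x y - w x y ^ 2)).
  set (c1 := dx w x y - dy z x y - (dx F2 x y - dy F1 x y
    - 2 * F x y * F3 x y + 2 * w x y * z x y)).
  set (c0 := - (dx z x y - (dy F x y + F x y * F2 x y - F x y * w x y
    - F1 x y * z x y + z x y ^ 2))).
  assert (E : forall p,
    field_A f (lam1 F3 F2 w z) x y p + lam1 F3 F2 w z x y p ^ 2
    - (dy3 f x y p + lam1 F3 F2 w z x y p * dp3 f x y p)
    = c2 * p ^ 2 + c1 * p + c0).
  { intros p; unfold field_A, total_D; rewrite Lx, Ly, Lp, fy, fp, Hf by auto.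
    unfold lam1, cubic, c0, c1, c2; ring. }
  unfold lie_system; split.
  - intros [Htr Hsym].
    destruct (quadratic_vanishes c2 c1 c0) as (E2 & E1 & E0).
    { intros p; rewrite <- E, Hsym; ring. }
    unfold c0, c1, c2 in *; repeat split; lra.
  - intros (Ew & Ew' & Ez & Ez'); split; [lra | ].
    intros p; apply Rminus_diag_uniq; rewrite E.
    assert (c2 = 0) as -> by (unfold c2; lra).
    assert (c1 = 0) as -> by (unfold c1; lra).
    assert (c0 = 0) as -> by (unfold c0; lra).
    ring.
Qed.

(** * Linearizing charts as solutions of a linear system *)

(** Vanishing of the Hessian of g for the connection with these Christoffel
    symbols, whose unparametrized geodesics are the solution curves of the
    cubic equation.  Two solutions with independent gradients form an affine
    chart of it, in which these curves are straight. *)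
Definition affine_chart_system (F3 F2 F1 F w z g : R -> R -> R) (x y : R) : Prop :=
  dx (dx g) x y = (2 * z x y - F1 x y) * dx g x y + F x y * dy g x y /\
  dx (dy g) x y = - w x y * dx g x y + z x y * dy g x y /\
  dy (dy g) x y = - F3 x y * dx g x y + (F2 x y - 2 * w x y) * dy g x y.

(** The two ways to compute g_xxy and g_xyy from the system, compared after
    eliminating the second derivatives. *)
Lemma affine_chart_compatibility D F3 F2 F1 F w z g x y :
  open_region D -> smooth_on D F3 -> smooth_on D F2 -> smooth_on D F1 ->
  smooth_on D F -> smooth_on D w -> smooth_on D z -> smooth_on D g ->
  (forall x y, D x y -> affine_chart_system F3 F2 F1 F w z g x y) -> D x y ->
  (dx w x y + 2 * dy z x y - dy F1 x y - F x y * F3 x y + w x y * z x y) * dx g x y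
  + (dy F x y + F x y * F2 x y - F x y * w x y - F1 x y * z x y + z x y ^ 2
     - dx z x y) * dy g x y = 0 /\
  (dx F3 x y - F1 x y * F3 x y + F2 x y * w x y + F3 x y * z x y - w x y ^ 2
     - dy w x y) * dx g x y
  + (2 * dx w x y + dy z x y - dx F2 x y + F x y * F3 x y - w x y * z x y) * dy g x y
  = 0.
Proof.
  intros HD s3 s2 s1 s0 sw sz sg H Hxy.
  assert (X3 := smooth_on_is_derive_x D F3 x y s3 Hxy).
  assert (X2 := smooth_on_is_derive_x D F2 x y s2 Hxy).
  assert (Y1 := smooth_on_is_derive_y D F1 x y s1 Hxy).
  assert (Y0 := smooth_on_is_derive_y D F x y s0 Hxy).
  assert (Xw := smooth_on_is_derive_x D w x y sw Hxy).
  assert (Yw := smooth_on_is_derive_y D w x y sw Hxy).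
  assert (Xz := smooth_on_is_derive_x D z x y sz Hxy).
  assert (Yz := smooth_on_is_derive_y D z x y sz Hxy).
  assert (sgx := smooth_on_dx D g sg); assert (sgy := smooth_on_dy D g sg).
  assert (Pxx := smooth_on_is_derive_x D (dx g) x y sgx Hxy).
  assert (Pxy := smooth_on_is_derive_y D (dx g) x y sgx Hxy).
  assert (Pyx := smooth_on_is_derive_x D (dy g) x y sgy Hxy).
  assert (Pyy := smooth_on_is_derive_y D (dy g) x y sgy Hxy).
  assert (Sch : forall u v, D u v -> dy (dx g) u v = dx (dy g) u v)
    by (intros; symmetry; now apply smooth_on_Schwarz with D).
  rewrite (Sch x y Hxy) in Pxy.
  destruct (H x y Hxy) as (Exx & Exy & Eyy).
  assert (Ly := locally_2d_1d_const_x _ _ _ (HD x y Hxy)).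
  assert (Lx := locally_2d_1d_const_y _ _ _ (HD x y Hxy)).
  assert (A1 : dy (dx (dx g)) x y
    = (2 * dy z x y - dy F1 x y) * dx g x y + (2 * z x y - F1 x y) * dx (dy g) x y
      + (dy F x y * dy g x y + F x y * dy (dy g) x y)).
  { apply is_derive_unique.
    apply is_derive_ext_loc with
      (fun t => (2 * z x t - F1 x t) * dx g x t + F x t * dy g x t).
    - revert Ly; apply filter_imp; intros t Ht; symmetry; exact (proj1 (H _ _ Ht)).
    - eapply is_derive_eq; [derive_rules | cbv beta; ring]. }
  assert (A2 : dx (dx (dy g)) x y
    = - dx w x y * dx g x y - w x y * dx (dx g) x y
      + (dx z x y * dy g x y + z x y * dx (dy g) x y)).
  { apply is_derive_unique.
    apply is_derive_ext_loc with
      (fun t => - w t y * dx g t y + z t y * dy g t y).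
    - revert Lx; apply filter_imp; intros t Ht; symmetry; exact (proj1 (proj2 (H _ _ Ht))).
    - eapply is_derive_eq; [derive_rules | cbv beta; ring]. }
  assert (A3 : dy (dx (dy g)) x y
    = - dy w x y * dx g x y - w x y * dx (dy g) x y
      + (dy z x y * dy g x y + z x y * dy (dy g) x y)).
  { apply is_derive_unique.
    apply is_derive_ext_loc with
      (fun t => - w x t * dx g x t + z x t * dy g x t).
    - revert Ly; apply filter_imp; intros t Ht; symmetry; exact (proj1 (proj2 (H _ _ Ht))).
    - eapply is_derive_eq; [derive_rules | cbv beta; ring]. }
  assert (A4 : dx (dy (dy g)) x y
    = - dx F3 x y * dx g x y - F3 x y * dx (dx g) x y
      + ((dx F2 x y - 2 * dx w x y) * dy g x y
         + (F2 x y - 2 * w x y) * dx (dy g) x y)).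
  { apply is_derive_unique.
    apply is_derive_ext_loc with
      (fun t => - F3 t y * dx g t y + (F2 t y - 2 * w t y) * dy g t y).
    - revert Lx; apply filter_imp; intros t Ht; symmetry; exact (proj2 (proj2 (H _ _ Ht))).
    - eapply is_derive_eq; [derive_rules | cbv beta; ring]. }
  assert (B1 : dx (dx (dy g)) x y = dy (dx (dx g)) x y).
  { rewrite <- (smooth_on_Schwarz D (dx g)) by auto.
    apply Derive_ext_loc; revert Lx; apply filter_imp.
    intros t Ht; symmetry; now apply Sch. }
  assert (B2 : dy (dx (dy g)) x y = dx (dy (dy g)) x y)
    by (symmetry; now apply (smooth_on_Schwarz D (dy g))).
  rewrite A1, A2 in B1; rewrite A3, A4 in B2.
  rewrite Exx, Exy, Eyy in B1, B2.
  split; lra.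
Qed.

Lemma jacobian_kernel (a b p1 p2 q1 q2 : R) :
  p1 * q2 - p2 * q1 <> 0 -> a * p1 + b * p2 = 0 -> a * q1 + b * q2 = 0 ->
  a = 0 /\ b = 0.
Proof.
  intros HJ H1 H2; split; apply Rmult_eq_reg_r with (2 := HJ).
  - transitivity (q2 * (a * p1 + b * p2) - p2 * (a * q1 + b * q2));
      [ring | rewrite H1, H2; ring].
  - transitivity (p1 * (a * q1 + b * q2) - q1 * (a * p1 + b * p2));
      [ring | rewrite H1, H2; ring].
Qed.

(** At a point where the gradients of two solutions are independent, a linear
    relation satisfied by both gradients has zero coefficients. *)
Lemma lie_system_of_affine_charts D F3 F2 F1 F w z phi psi x y :
  open_region D -> smooth_on D F3 -> smooth_on D F2 -> smooth_on D F1 ->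
  smooth_on D F -> smooth_on D w -> smooth_on D z ->
  smooth_on D phi -> smooth_on D psi ->
  (forall x y, D x y -> affine_chart_system F3 F2 F1 F w z phi x y) ->
  (forall x y, D x y -> affine_chart_system F3 F2 F1 F w z psi x y) ->
  D x y -> jacobian phi psi x y <> 0 -> lie_system F3 F2 F1 F w z x y.
Proof.
  intros HD s3 s2 s1 s0 sw sz sphi spsi Hphi Hpsi Hxy HJ.
  destruct (affine_chart_compatibility D F3 F2 F1 F w z phi x y) as [P1 P2]; auto.
  destruct (affine_chart_compatibility D F3 F2 F1 F w z psi x y) as [Q1 Q2]; auto.
  destruct (jacobian_kernel _ _ _ _ _ _ HJ P1 Q1) as [E1 E2].
  destruct (jacobian_kernel _ _ _ _ _ _ HJ P2 Q2) as [E3 E4].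
  unfold lie_system; repeat split; lra.
Qed.

(** Written out, the numerator of u_tt is q J plus a cubic in p that is
    alternating in phi and psi; the system turns each of its
    coefficients into a multiple of J. *)
Lemma u_tt_affine_charts D F3 F2 F1 F w z phi psi x y p q :
  open_region D -> smooth_on D phi -> smooth_on D psi -> D x y ->
  affine_chart_system F3 F2 F1 F w z phi x y ->
  affine_chart_system F3 F2 F1 F w z psi x y ->
  dx phi x y + dy phi x y * p <> 0 ->
  u_tt phi psi x y p q
  = jacobian phi psi x y * (q + cubic F3 F2 F1 F x y p)
    / (dx phi x y + dy phi x y * p) ^ 3.
Proof.
  intros HD sphi spsi Hxy (E1 & E2 & E3) (G1 & G2 & G3) HM.
  assert (Pxx := smooth_on_is_derive_x D _ x y (smooth_on_dx D phi sphi) Hxy).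
  assert (Pxy := smooth_on_is_derive_y D _ x y (smooth_on_dx D phi sphi) Hxy).
  assert (Pyx := smooth_on_is_derive_x D _ x y (smooth_on_dy D phi sphi) Hxy).
  assert (Pyy := smooth_on_is_derive_y D _ x y (smooth_on_dy D phi sphi) Hxy).
  assert (Qxx := smooth_on_is_derive_x D _ x y (smooth_on_dx D psi spsi) Hxy).
  assert (Qxy := smooth_on_is_derive_y D _ x y (smooth_on_dx D psi spsi) Hxy).
  assert (Qyx := smooth_on_is_derive_x D _ x y (smooth_on_dy D psi spsi) Hxy).
  assert (Qyy := smooth_on_is_derive_y D _ x y (smooth_on_dy D psi spsi) Hxy).
  rewrite <- (smooth_on_Schwarz D phi x y HD sphi Hxy) in Pxy.
  rewrite <- (smooth_on_Schwarz D psi x y HD spsi Hxy) in Qxy.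
  assert (Dx : dx3 (u_t phi psi) x y p
    = ((dx (dx psi) x y + dx (dy psi) x y * p) * (dx phi x y + dy phi x y * p)
       - (dx psi x y + dy psi x y * p) * (dx (dx phi) x y + dx (dy phi) x y * p))
      / (dx phi x y + dy phi x y * p) ^ 2).
  { apply is_derive_unique; unfold u_t.
    eapply is_derive_eq; [derive_rules; exact HM | cbv beta; now field]. }
  assert (Dy : dy3 (u_t phi psi) x y p
    = ((dx (dy psi) x y + dy (dy psi) x y * p) * (dx phi x y + dy phi x y * p)
       - (dx psi x y + dy psi x y * p) * (dx (dy phi) x y + dy (dy phi) x y * p))
      / (dx phi x y + dy phi x y * p) ^ 2).
  { apply is_derive_unique; unfold u_t.
    eapply is_derive_eq; [derive_rules; exact HM | cbv beta; now field]. }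
  assert (Dp : dp3 (u_t phi psi) x y p
    = (dy psi x y * (dx phi x y + dy phi x y * p)
       - (dx psi x y + dy psi x y * p) * dy phi x y)
      / (dx phi x y + dy phi x y * p) ^ 2).
  { apply is_derive_unique; unfold u_t.
    eapply is_derive_eq; [derive_rules; exact HM | cbv beta; now field]. }
  unfold u_tt, total_D; rewrite Dx, Dy, Dp, E1, E2, E3, G1, G2, G3.
  unfold cubic, jacobian; now field.
Qed.

(** * Existence of linearizing charts *)

(** The unknowns g, g_x, g_y of [affine_chart_system] written as a first-order
    linear system.  Keeping g among the unknowns yields the potential of
    the 1-form g_x dx + g_y dy in the same step. *)
Inductive jet : Type := jet_value | jet_dx | jet_dy.

Definition jets : list jet := [jet_value; jet_dx; jet_dy].

Definition jet_matrix_x (F1 F w z : R -> R -> R) (i k : jet) : R -> R -> R :=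
  match i, k with
  | jet_value, jet_dx => fun _ _ => 1
  | jet_dx, jet_dx => fun x y => 2 * z x y - F1 x y
  | jet_dx, jet_dy => F
  | jet_dy, jet_dx => fun x y => - w x y
  | jet_dy, jet_dy => z
  | _, _ => fun _ _ => 0
  end.

Definition jet_matrix_y (F3 F2 w z : R -> R -> R) (i k : jet) : R -> R -> R :=
  match i, k with
  | jet_value, jet_dy => fun _ _ => 1
  | jet_dx, jet_dx => fun x y => - w x y
  | jet_dx, jet_dy => z
  | jet_dy, jet_dx => fun x y => - F3 x y
  | jet_dy, jet_dy => fun x y => F2 x y - 2 * w x y
  | _, _ => fun _ _ => 0
  end.

(** For the matrices of the first-order system, vanishing curvature amounts to
    [lie_system]: the row of g expresses the symmetry of g_xy, and the other
    two are [affine_chart_compatibility]. *)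
Lemma affine_chart_exists D F3 F2 F1 F w z x0 y0 a b :
  open_region D -> smooth_on D F3 -> smooth_on D F2 -> smooth_on D F1 ->
  smooth_on D F -> smooth_on D w -> smooth_on D z ->
  (forall x y, D x y -> lie_system F3 F2 F1 F w z x y) -> D x0 y0 ->
  exists g, smooth_near g x0 y0 /\ dx g x0 y0 = a /\ dy g x0 y0 = b /\
    locally_2d (affine_chart_system F3 F2 F1 F w z g) x0 y0.
Proof.
  intros HD s3 s2 s1 s0 sw sz HL H0.
  set (A := jet_matrix_x F1 F w z); set (B := jet_matrix_y F3 F2 w z).
  assert (sA : forall i k, smooth_on D (A i k)).
  { intros [] []; simpl;
      auto using smooth_on_const, smooth_on_minus, smooth_on_opp, smooth_on_mult. }
  assert (sB : forall i k, smooth_on D (B i k)).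
  { intros [] []; simpl;
      auto using smooth_on_const, smooth_on_minus, smooth_on_opp, smooth_on_mult. }
  assert (Hflat : forall x y, D x y -> forall i k,
    dy (A i k) x y
      + matmul jet jets (fun i k => A i k x y) (fun i k => B i k x y) i k
    = dx (B i k) x y
      + matmul jet jets (fun i k => B i k x y) (fun i k => A i k x y) i k).
  { intros x y Hxy i k.
    assert (X3 := smooth_on_is_derive_x D F3 x y s3 Hxy).
    assert (X2 := smooth_on_is_derive_x D F2 x y s2 Hxy).
    assert (Y1 := smooth_on_is_derive_y D F1 x y s1 Hxy).
    assert (Xw := smooth_on_is_derive_x D w x y sw Hxy).
    assert (Yw := smooth_on_is_derive_y D w x y sw Hxy).
    assert (Yz := smooth_on_is_derive_y D z x y sz Hxy).
    assert (C1 : forall c, dy (fun _ _ => c) x y = 0)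
      by exact (fun c => Derive_const c y).
    assert (C2 : forall c, dx (fun _ _ => c) x y = 0)
      by exact (fun c => Derive_const c x).
    assert (A1 : dy (fun x y => 2 * z x y - F1 x y) x y = 2 * dy z x y - dy F1 x y).
    { apply is_derive_unique.
      eapply is_derive_eq; [derive_rules | cbv beta; ring]. }
    assert (A2 : dy (fun x y => - w x y) x y = - dy w x y)
      by (apply is_derive_unique; derive_rules).
    assert (B1 : dx (fun x y => - w x y) x y = - dx w x y)
      by (apply is_derive_unique; derive_rules).
    assert (B2 : dx (fun x y => - F3 x y) x y = - dx F3 x y)
      by (apply is_derive_unique; derive_rules).
    assert (B3 : dx (fun x y => F2 x y - 2 * w x y) x y = dx F2 x y - 2 * dx w x y).
    { apply is_derive_unique.
      eapply is_derive_eq; [derive_rules | cbv beta; ring]. }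
    destruct (HL x y Hxy) as (E1 & E2 & E3 & E4).
    destruct i, k; unfold matmul; simpl;
      rewrite ?C1, ?C2, ?A1, ?A2, ?B1, ?B2, ?B3, ?E1, ?E2, ?E3, ?E4; field. }
  set (v0 := fun i => match i with jet_value => 0 | jet_dx => a | jet_dy => b end).
  destruct (flat_linear_system jet jets ltac:(intros []; simpl; tauto) A B v0 x0 y0)
    as (V & HV0 & HV).
  { apply locally_2d_impl with (2 := HD x0 y0 H0), locally_2d_forall.
    intros x y Hxy i k; split; [apply sA | apply sB]; exact Hxy. }
  { apply locally_2d_impl with (2 := HD x0 y0 H0), locally_2d_forall; auto. }
  set (D' := locally_2d (fun x y => D x y /\ forall i, continuity_2d_pt (V i) x y /\
      is_derive (fun s => V i s y) x (act_on jet jets A V i x y) /\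
      is_derive (fun t => V i x t) y (act_on jet jets B V i x y))).
  assert (HD' : open_region D') by apply open_region_locally.
  assert (H0' : D' x0 y0) by (apply locally_2d_and; auto).
  assert (HP : forall x y, D' x y -> D x y /\ forall i, continuity_2d_pt (V i) x y /\
      is_derive (fun s => V i s y) x (act_on jet jets A V i x y) /\
      is_derive (fun t => V i x t) y (act_on jet jets B V i x y))
    by (intros x y; apply locally_2d_singleton).
  assert (sV : forall i, smooth_on D' (V i)).
  { apply (linear_system_solution_smooth jet jets D' A B); auto.
    - intros i k n x y Hxy; apply sA, HP, Hxy.
    - intros i k n x y Hxy; apply sB, HP, Hxy.
    - intros x y Hxy; apply HP, Hxy. }
  assert (Vx : forall i x y, D' x y -> dx (V i) x y = act_on jet jets A V i x y).
  { intros i x y Hxy; apply is_derive_unique.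
    exact (proj1 (proj2 (proj2 (HP x y Hxy) i))). }
  assert (Vy : forall i x y, D' x y -> dy (V i) x y = act_on jet jets B V i x y).
  { intros i x y Hxy; apply is_derive_unique.
    exact (proj2 (proj2 (proj2 (HP x y Hxy) i))). }
  assert (gx : forall x y, D' x y -> dx (V jet_value) x y = V jet_dx x y).
  { intros x y Hxy; rewrite Vx by auto; unfold act_on, act; simpl; ring. }
  assert (gy : forall x y, D' x y -> dy (V jet_value) x y = V jet_dy x y).
  { intros x y Hxy; rewrite Vy by auto; unfold act_on, act; simpl; ring. }
  exists (V jet_value); split; [now apply smooth_near_on with D' | split; [ | split]].
  - rewrite gx by auto; apply HV0.
  - rewrite gy by auto; apply HV0.
  - apply locally_2d_impl with (2 := HD' x0 y0 H0'), locally_2d_forall.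
    intros x y Hxy.
    assert (Ly := locally_2d_1d_const_x _ _ _ (HD' x y Hxy)).
    assert (Lx := locally_2d_1d_const_y _ _ _ (HD' x y Hxy)).
    assert (gxx : dx (dx (V jet_value)) x y = dx (V jet_dx) x y)
      by (apply Derive_ext_loc; revert Lx; apply filter_imp; intros t; apply gx).
    assert (gyx : dx (dy (V jet_value)) x y = dx (V jet_dy) x y)
      by (apply Derive_ext_loc; revert Lx; apply filter_imp; intros t; apply gy).
    assert (gyy : dy (dy (V jet_value)) x y = dy (V jet_dy) x y)
      by (apply Derive_ext_loc; revert Ly; apply filter_imp; intros t; apply gy).
    unfold affine_chart_system.
    rewrite gxx, gyx, gyy, gx, gy by auto.
    rewrite !Vx, Vy by auto; unfold act_on, act; simpl.
    repeat split; ring.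
Qed.

(** * The linearization criterion *)

Lemma smooth_on_locally P g :
  (forall x y, P x y -> forall n, ex_diff_n g n x y) -> smooth_on (locally_2d P) g.
Proof.
  intros H n x y Hxy; apply H; now apply locally_2d_singleton.
Qed.

(** The chart says nothing about the equation at the slope where
    phi_x + phi_y p = 0; there is at most one such slope, so continuity in p
    fills the gap. *)
Lemma affine_null_continuous (h : R -> R) (a b : R) :
  (a <> 0 \/ b <> 0) -> (forall p, continuous h p) ->
  (forall p, a + b * p <> 0 -> h p = 0) -> forall p, h p = 0.
Proof.
  intros Hab Hc Hh p.
  destruct (Req_dec (h p) 0) as [ | Hp]; [assumption | exfalso].
  assert (Hl : locally p (fun t => h t <> 0)).
  { apply (Hc p (fun v => v <> 0)), open_neq, Hp. }
  destruct Hl as [e He].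
  assert (He0 := cond_pos e).
  assert (Hp0 : a + b * p = 0).
  { destruct (Req_dec (a + b * p) 0) as [ | Hn]; auto; now apply Hh in Hn. }
  assert (Hb : b <> 0).
  { intros ->; destruct Hab as [Ha | Hb]; [apply Ha | ]; lra. }
  apply (He (p + e / 2)).
  - change (Rabs (p + e / 2 - p) < e).
    replace (p + e / 2 - p) with (e / 2) by ring.
    rewrite Rabs_pos_eq; lra.
  - apply Hh; replace (a + b * (p + e / 2)) with (a + b * p + b * (e / 2)) by ring.
    rewrite Hp0, Rplus_0_l; apply Rmult_integral_contrapositive; split; lra.
Qed.

Lemma Cn3_on_lam1 D n F3 F2 w z :
  open_region D -> smooth_on D F3 -> smooth_on D F2 -> smooth_on D w ->
  smooth_on D z -> Cn3_on D n (lam1 F3 F2 w z).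
Proof.
  intros HD s3 s2 sw sz x y p Hxy.
  apply (ex_diff3_n_ext D) with (fun x y p =>
    (- F3 x y * (p * p) + (w x y - F2 x y) * p) + - z x y); auto.
  - intros u v q _; unfold lam1; ring.
  - revert x y p Hxy.
    change (Cn3_on D n (fun x y p =>
      (- F3 x y * (p * p) + (w x y - F2 x y) * p) + - z x y)).
    apply (Cn3_on_plus D n (fun x y p => - F3 x y * (p * p) + (w x y - F2 x y) * p)
      (fun x y _ => - z x y)); auto.
    + apply (Cn3_on_plus D n (fun x y p => - F3 x y * (p * p))
        (fun x y p => (w x y - F2 x y) * p)); auto.
      * apply (Cn3_on_mult D n (fun x y _ => - F3 x y) (fun _ _ p => p * p)); auto.
        -- apply (Cn3_on_lift D n (fun x y => - F3 x y)); auto.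
           now apply smooth_on_opp.
        -- apply (Cn3_on_mult D n (fun _ _ p => p) (fun _ _ p => p));
             auto using Cn3_on_slope.
      * apply (Cn3_on_mult D n (fun x y _ => w x y - F2 x y) (fun _ _ p => p));
          auto using Cn3_on_slope.
        apply (Cn3_on_lift D n (fun x y => w x y - F2 x y)); auto.
        now apply smooth_on_minus.
    + apply (Cn3_on_lift D n (fun x y => - z x y)); auto.
      now apply smooth_on_opp.
Qed.

(** Cramer's rule: the six equations that say that phi and psi solve
    [affine_chart_system] form three 2 x 2 linear systems with determinant J
    for the six coefficients. *)
Theorem linearizable_lie_system (f : R -> R -> R -> R) (x0 y0 : R) :
  smooth3_near f x0 y0 -> linearizable f x0 y0 ->
  exists D F3 F2 F1 F w z, open_region D /\ D x0 y0 /\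
    smooth_on D F3 /\ smooth_on D F2 /\ smooth_on D F1 /\ smooth_on D F /\
    smooth_on D w /\ smooth_on D z /\
    (forall x y, D x y -> forall p, f x y p = - cubic F3 F2 F1 F x y p) /\
    (forall x y, D x y -> lie_system F3 F2 F1 F w z x y).
Proof.
  intros hf (phi & psi & (Sphi & Spsi & HJ) & Hlin).
  set (P := fun x y => ((forall p n, ex_diff3_n f n x y p) /\
    (forall n, ex_diff_n phi n x y) /\ (forall n, ex_diff_n psi n x y)) /\
    jacobian phi psi x y <> 0 /\
    forall p q, dx phi x y + dy phi x y * p <> 0 ->
      (u_tt phi psi x y p q = 0 <-> q = f x y p)).
  set (D := locally_2d P).
  assert (HD : open_region D) by apply open_region_locally.
  assert (H0 : D x0 y0)
    by (repeat apply locally_2d_and; auto).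
  assert (HP : forall x y, D x y -> P x y) by (intros x y; apply locally_2d_singleton).
  assert (sphi : smooth_on D phi) by (apply smooth_on_locally; intros x y H; apply H).
  assert (spsi : smooth_on D psi) by (apply smooth_on_locally; intros x y H; apply H).
  assert (HJD : forall x y, D x y -> jacobian phi psi x y <> 0)
    by (intros x y H; apply (HP x y H)).
  assert (sJ : smooth_on D (jacobian phi psi)).
  { apply (smooth_on_minus D (fun x y => dx phi x y * dy psi x y)
      (fun x y => dy phi x y * dx psi x y)); auto;
      apply smooth_on_mult; auto using smooth_on_dx, smooth_on_dy. }
  assert (sbr : forall g1 h1 g2 h2, smooth_on D g1 -> smooth_on D h1 ->
    smooth_on D g2 -> smooth_on D h2 ->
    smooth_on D (fun x y => (g1 x y * h2 x y - h1 x y * g2 x y) / jacobian phi psi x y)).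
  { intros; apply (smooth_on_div D (fun x y => g1 x y * h2 x y - h1 x y * g2 x y)); auto.
    apply (smooth_on_minus D (fun x y => g1 x y * h2 x y) (fun x y => h1 x y * g2 x y));
      auto; now apply smooth_on_mult. }
  assert (d1 := smooth_on_dx D phi sphi); assert (d2 := smooth_on_dy D phi sphi).
  assert (d3 := smooth_on_dx D psi spsi); assert (d4 := smooth_on_dy D psi spsi).
  assert (d5 := smooth_on_dx D _ d1); assert (d6 := smooth_on_dx D _ d2).
  assert (d7 := smooth_on_dy D _ d2).
  assert (e5 := smooth_on_dx D _ d3); assert (e6 := smooth_on_dx D _ d4).
  assert (e7 := smooth_on_dy D _ d4).
  set (w := fun x y => (dy phi x y * dx (dy psi) x y - dy psi x y * dx (dy phi) x y)
    / jacobian phi psi x y).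
  set (z := fun x y => (dx phi x y * dx (dy psi) x y - dx psi x y * dx (dy phi) x y)
    / jacobian phi psi x y).
  set (F3 := fun x y => (dy phi x y * dy (dy psi) x y - dy psi x y * dy (dy phi) x y)
    / jacobian phi psi x y).
  set (F2 := fun x y => (dx phi x y * dy (dy psi) x y - dx psi x y * dy (dy phi) x y)
    / jacobian phi psi x y + 2 * w x y).
  set (F1 := fun x y => 2 * z x y
    - (dx (dx phi) x y * dy psi x y - dy phi x y * dx (dx psi) x y)
      / jacobian phi psi x y).
  set (F := fun x y => (dx phi x y * dx (dx psi) x y - dx psi x y * dx (dx phi) x y)
    / jacobian phi psi x y).
  assert (sw : smooth_on D w) by now apply sbr.
  assert (sz : smooth_on D z) by now apply sbr.
  assert (s3 : smooth_on D F3) by now apply sbr.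
  assert (s0 : smooth_on D F) by now apply sbr.
  assert (s2 : smooth_on D F2).
  { apply smooth_on_plus; [exact HD | now apply sbr | ].
    apply smooth_on_mult; auto using smooth_on_const. }
  assert (s1 : smooth_on D F1).
  { apply smooth_on_minus; [exact HD | | now apply sbr].
    apply smooth_on_mult; auto using smooth_on_const. }
  assert (Hphi : forall x y, D x y -> affine_chart_system F3 F2 F1 F w z phi x y).
  { intros x y Hxy; specialize (HJD x y Hxy).
    unfold affine_chart_system, F3, F2, F1, F, w, z, jacobian in *.
    repeat split; field; auto. }
  assert (Hpsi : forall x y, D x y -> affine_chart_system F3 F2 F1 F w z psi x y).
  { intros x y Hxy; specialize (HJD x y Hxy).
    unfold affine_chart_system, F3, F2, F1, F, w, z, jacobian in *.
    repeat split; field; auto. }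
  exists D, F3, F2, F1, F, w, z.
  refine (conj HD (conj H0 (conj s3 (conj s2 (conj s1 (conj s0 (conj sw (conj sz
    (conj _ _))))))))).
  - intros x y Hxy p; destruct (HP x y Hxy) as ((Hf & _) & HJxy & Hq).
    apply Rminus_diag_uniq.
    revert p; apply affine_null_continuous with (dx phi x y) (dy phi x y).
    + destruct (Req_dec (dx phi x y) 0) as [E1 | ]; [right | now left].
      intros E2; apply HJxy; unfold jacobian; rewrite E1, E2; ring.
    + intros p.
      apply (continuous_minus (fun p => f x y p)
        (fun p => - cubic F3 F2 F1 F x y p)).
      * apply (ex_derive_continuous (fun p => f x y p)).
        apply (Hf p 1%nat).
      * apply (ex_derive_continuous (fun p => - cubic F3 F2 F1 F x y p)).
        unfold cubic; auto_derive; auto.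
    + intros p HM.
      destruct (Hq p (- cubic F3 F2 F1 F x y p) HM) as [Hq' _].
      rewrite <- Hq'; [ring | ].
      rewrite (u_tt_affine_charts D F3 F2 F1 F w z) by auto.
      unfold Rdiv; ring.
  - intros x y Hxy; apply (lie_system_of_affine_charts D) with phi psi; auto.
Qed.

(** Two charts with gradients (1, 0) and (0, 1) at the base point have
    Jacobian 1 there, hence nonzero Jacobian nearby. *)
Theorem lie_system_linearizable D f F3 F2 F1 F w z x0 y0 :
  open_region D -> D x0 y0 ->
  smooth_on D F3 -> smooth_on D F2 -> smooth_on D F1 -> smooth_on D F ->
  smooth_on D w -> smooth_on D z ->
  (forall x y, D x y -> forall p, f x y p = - cubic F3 F2 F1 F x y p) ->
  (forall x y, D x y -> lie_system F3 F2 F1 F w z x y) ->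
  linearizable f x0 y0.
Proof.
  intros HD H0 s3 s2 s1 s0 sw sz Hf HL.
  destruct (affine_chart_exists D F3 F2 F1 F w z x0 y0 1 0)
    as (phi & Sphi & phix & phiy & Hphi); auto.
  destruct (affine_chart_exists D F3 F2 F1 F w z x0 y0 0 1)
    as (psi & Spsi & psix & psiy & Hpsi); auto.
  set (P := fun x y => (D x y /\ affine_chart_system F3 F2 F1 F w z phi x y /\
    affine_chart_system F3 F2 F1 F w z psi x y) /\
    (forall n, ex_diff_n phi n x y) /\ (forall n, ex_diff_n psi n x y)).
  set (D' := locally_2d P).
  assert (HD' : open_region D') by apply open_region_locally.
  assert (H0' : D' x0 y0) by exact (locally_2d_and _ _ _ _
    (locally_2d_and _ _ _ _ (HD x0 y0 H0) (locally_2d_and _ _ _ _ Hphi Hpsi))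
    (locally_2d_and _ _ _ _ Sphi Spsi)).
  assert (HP : forall x y, D' x y -> P x y)
    by (intros x y; apply locally_2d_singleton).
  assert (sphi : smooth_on D' phi) by (apply smooth_on_locally; intros x y H; apply H).
  assert (spsi : smooth_on D' psi) by (apply smooth_on_locally; intros x y H; apply H).
  assert (HJ : locally_2d (fun x y => jacobian phi psi x y <> 0) x0 y0).
  { apply continuity_2d_pt_neq_0.
    - apply (smooth_on_continuity D'); auto.
      apply (smooth_on_minus D' (fun x y => dx phi x y * dy psi x y)
        (fun x y => dy phi x y * dx psi x y)); auto;
        apply smooth_on_mult; auto using smooth_on_dx, smooth_on_dy.
    - unfold jacobian; rewrite phix, phiy, psix, psiy; lra. }
  exists phi, psi; split; [repeat split; auto | ].
  apply locally_2d_impl with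
    (2 := locally_2d_and _ _ _ _ HJ (HD' x0 y0 H0')), locally_2d_forall.
  intros x y [HJxy Hxy] p q HM.
  destruct (HP x y Hxy) as ((HDxy & Cphi & Cpsi) & _).
  rewrite (u_tt_affine_charts D' F3 F2 F1 F w z), Hf by auto.
  split; intros E.
  - apply (f_equal (fun t => t * (dx phi x y + dy phi x y * p) ^ 3
      / jacobian phi psi x y)) in E.
    field_simplify in E; auto; lra.
  - rewrite E; unfold Rdiv; ring.
Qed.

Theorem corollary2p2 (f : R -> R -> R -> R) (x0 y0 : R)
  (hf : smooth3_near f x0 y0) :
  linearizable f x0 y0 <->
  (exists F3 F2 F1 F : R -> R -> R,
    (smooth_near F3 x0 y0 /\ smooth_near F2 x0 y0 /\
     smooth_near F1 x0 y0 /\ smooth_near F x0 y0) /\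
    locally_2d (fun x y => forall p : R,
      f x y p + F3 x y * p ^ 3 + F2 x y * p ^ 2 + F1 x y * p + F x y = 0)
      x0 y0 /\
    exists w z : R -> R -> R,
      smooth_near w x0 y0 /\ smooth_near z x0 y0 /\
      locally_2d (fun x y =>
        dx w x y + dy z x y = 1 / 3 * (dx F2 x y + dy F1 x y)) x0 y0 /\
      lambda_symmetry_dy f
        (fun x y p => - F3 x y * p ^ 2 - (F2 x y - w x y) * p - z x y)
        x0 y0).
Proof.
  split.
  - intros Hlin.
    destruct (linearizable_lie_system f x0 y0 hf Hlin)
      as (D & F3 & F2 & F1 & F & w & z & HD & H0 & s3 & s2 & s1 & s0 & sw & sz & Hf & HL).
    assert (near : forall P : R -> R -> Prop, (forall x y, D x y -> P x y) ->
      locally_2d P x0 y0).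
    { intros P HP; apply locally_2d_impl with (2 := HD x0 y0 H0), locally_2d_forall; auto. }
    assert (HE := fun x y Hxy => proj2 (lambda_symmetry_lie_system D f F3 F2 F1 F w z x y
      HD s3 s2 s1 s0 sw sz Hf Hxy) (HL x y Hxy)).
    exists F3, F2, F1, F; split; [ | split].
    3: exists w, z; split; [ | split; [ | split; [ | split]]];
      eauto using smooth_near_on.
    + repeat split; eauto using smooth_near_on.
    + apply near; intros x y Hxy p; rewrite Hf by auto; unfold cubic; ring.
    + apply near; intros x y Hxy; apply HE, Hxy.
    + apply near; intros x y Hxy p n; now apply (Cn3_on_lam1 D n F3 F2 w z).
    + apply near; intros x y Hxy; apply HE, Hxy.
  - intros (F3 & F2 & F1 & F & (S3 & S2 & S1 & S0) & Hf & w & z & Sw & Sz & Htr & _ & Hsym).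
    set (P := fun x y =>
      ((forall n, ex_diff_n F3 n x y) /\ (forall n, ex_diff_n F2 n x y) /\
       (forall n, ex_diff_n F1 n x y) /\ (forall n, ex_diff_n F n x y) /\
       (forall n, ex_diff_n w n x y) /\ (forall n, ex_diff_n z n x y)) /\
      (forall p, f x y p + F3 x y * p ^ 3 + F2 x y * p ^ 2 + F1 x y * p + F x y = 0) /\
      dx w x y + dy z x y = 1 / 3 * (dx F2 x y + dy F1 x y) /\
      forall p, field_A f (lam1 F3 F2 w z) x y p + lam1 F3 F2 w z x y p ^ 2
        = dy3 f x y p + lam1 F3 F2 w z x y p * dp3 f x y p).
    assert (H0 : locally_2d P x0 y0) by (repeat apply locally_2d_and; auto).
    assert (HD := open_region_locally P).
    assert (HP : forall x y, locally_2d P x y -> P x y)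
      by (intros x y; apply locally_2d_singleton).
    assert (HfD : forall x y, locally_2d P x y -> forall p,
      f x y p = - cubic F3 F2 F1 F x y p).
    { intros x y Hxy p; destruct (HP x y Hxy) as (_ & H & _).
      specialize (H p); unfold cubic; lra. }
    assert (s3 : smooth_on (locally_2d P) F3)
      by (apply smooth_on_locally; intros x y H; apply H).
    assert (s2 : smooth_on (locally_2d P) F2)
      by (apply smooth_on_locally; intros x y H; apply H).
    assert (s1 : smooth_on (locally_2d P) F1)
      by (apply smooth_on_locally; intros x y H; apply H).
    assert (s0 : smooth_on (locally_2d P) F)
      by (apply smooth_on_locally; intros x y H; apply H).
    assert (sw : smooth_on (locally_2d P) w)
      by (apply smooth_on_locally; intros x y H; apply H).
    assert (sz : smooth_on (locally_2d P) z)
      by (apply smooth_on_locally; intros x y H; apply H).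
    apply (lie_system_linearizable (locally_2d P) f F3 F2 F1 F w z); auto.
    intros x y Hxy; apply (lambda_symmetry_lie_system (locally_2d P) f); auto.
    apply (HP x y Hxy).
Qed.
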